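(* The contravariant functor $\mathcal{P}:\mathbf{SDS}\to\mathbf{OBD}$ is a full and faithful functor.
   Context: **Bratteli diagrams.** A Bratteli diagram $(V,E)$ consists of a vertex set $V=V_0\sqcup V_1\sqcup\cdots$ with each $V_n$ finite and non-empty and $V_0$ a singleton, and an edge set $E=E_1\sqcup E_2\sqcup\cdots$ with each $E_n$ finite and non-empty, together with maps $r,s:E\to V$ (range, source) such that $r(E_n)\subseteq V_n$, $s(E_n)\subseteq V_{n-1}$, $s^{-1}\{v\}\neq\varnothing$ for all $v\in V$ and $r^{-1}\{v\}\ne\varnothing$ for all $v\in V\setminus V_0$. An ordered Bratteli diagram $(V,E,\geq)$ is a Bratteli diagram with a partial order on $E$ such that $e,e'$ are comparable iff $r(e)=r(e')$. **Edge sets.** An ordered edge set from a finite set $S$ to a finite set $T$ is a finite set $F$ with maps $s:F\to S$, $r:F\to T$ and a linear order on each $r^{-1}\{w\}$, $w\in T$. If $G$ is an ordered edge set from $T$ to $U$, then $F\circ G=\{(e,g)\in F\times G: r(e)=s(g)\}$, with source $s(e)$, range $r(g)$, and order: for $r(g)=r(g')$, $(e,g)<(e',g')$ iff $g<g'$, or $g=g'$ and $e<e'$. Write $F\cong F'$ if there is a bijection $F\to F'$ preserving sources, ranges and order. For $k<l$, $E_{k,l}=E_{k+1}\circ\cdots\circ E_l$; $E_{k,k}$ consists of one edge from $v$ to $v$ for each $v\in V_k$. **The category $\mathbf{OBD}$.** Objects: ordered Bratteli diagrams. An ordered premorphism $f:B=(V,E,\ge)\to C=(W,S,\ge)$ is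 a triple $(F,(f_n)_{n\ge0},\geq)$ where $(f_n)$ is an unbounded sequence of integers with $0=f_0\le f_1\le\cdots$, and $F=F_0\sqcup F_1\sqcup\cdots$ where each $F_n$ is a non-empty finite ordered edge set from $V_n$ to $W_{f_n}$ such that every $v\in V_n$ is the source of some edge of $F_n$ (that is, $s^{-1}\{v\}\neq\varnothing$ for all $v\in V$) and every $w\in W_{f_n}$ is the range of some edge of $F_n$, $F_0$ is a singleton, and $E_{n+1}\circ F_{n+1}\cong F_n\circ S_{f_n,f_{n+1}}$ for all $n\ge0$. The composition of $f:B\to C$ and $g=(G,(g_n),\ge):C\to D$ is $gf=(H,(h_n),\ge)$ with $h_n=g_{f_n}$, $H_n=F_n\circ G_{f_n}$. Premorphisms $f,g:B\to C$ are equivalent if there are positive integers $n_1<m_1<n_2<m_2<\cdots$ with $f_{n_k}<g_{m_k}<f_{n_{k+1}}$ and, for all $k\ge1$, $E_{n_k,m_k}\circ G_{m_k}\cong F_{n_k}\circ S_{f_{n_k},g_{m_k}}$ and $E_{m_k,n_{k+1}}\circ F_{n_{k+1}}\cong G_{m_k}\circ S_{g_{m_k},f_{n_{k+1}}}$. Morphisms in $\mathbf{OBD}$ are equivalence classes $[f]$, with $[g][f]=[gf]$. **The category $\mathbf{SDS}$.** An essentially minimal totally disconnected dynamical system $(X,\varphi,x_0)$ consists of a metrizable compact totally disconnected space $X$, a homeomorphism $\varphi$ of $X$ such that $(X,\varphi)$ has a unique minimal (non-empty closed invariant) subset, and a point $x_0$ of that subset. A Kakutani–Rokhlin partition for it is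 a finite partition $P=\{Z(k,j): 1\le k\le K,\ 1\le j\le J(k)\}$ of $X$ into non-empty clopen sets with $\varphi(Z(k,j))=Z(k,j+1)$ for $1\le j<J(k)$, and such that the top $Z=\bigcup_kZ(k,J(k))$ contains $x_0$ and $\varphi(Z)=\bigcup_kZ(k,1)$; the sequences $(Z(k,1),\ldots,Z(k,J(k)))$ are its towers. A system of Kakutani–Rokhlin partitions is a sequence $\mathcal{R}=(P_n)_{n\ge0}$ of such partitions with $P_0=\{X\}$, $P_{n+1}$ refining $P_n$ (written $P_n\le P_{n+1}$), the tops $Z_n$ of $P_n$ ($n\ge1$) decreasing with intersection $\{x_0\}$, and $\bigcup_nP_n$ a basis for the topology of $X$. Objects of $\mathbf{SDS}$ are quadruples $(X,\varphi,x_0,\mathcal{R})$; morphisms $(X,\varphi,x_0,\mathcal{R})\to(Y,\psi,y_0,\mathcal{S})$ are continuous maps $\alpha:X\to Y$ with $\alpha\circ\varphi=\psi\circ\alpha$ and $\alpha(x_0)=y_0$. **The edge set $E(P,Q)$.** If $P\le Q$ are Kakutani–Rokhlin partitions and the top of $P$ contains the top of $Q$, $E(P,Q)$ is the set of triples $(S,T,k)$ with $S=(Z_1,\ldots,Z_n)$ a tower of $P$, $T=(Y_1,\ldots,Y_m)$ a tower of $Q$, $k\ge0$ an integer with $Y_{k+j}\subseteq Z_j$ for $1\le j\le n$; source $S$, range $T$, and $(S,T,k)\le(S',T',k')$ iff $T=T'$ and $k\le k'$. **The functor $\mathcal{P}$.** On objects with $\mathcal{R}=(P_n)$: $\mathcal{P}(X,\varphi,x_0,\mathcal{R})$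 has $V_n=\{(n,T): T\text{ a tower of }P_n\}$ and $E_n$ the copy $\{(n,S,T,k):(S,T,k)\in E(P_{n-1},P_n)\}$ of $E(P_{n-1},P_n)$ with its order. For a morphism $\alpha:(X,\varphi,x_0,(P_n))\to(Y,\psi,y_0,(Q_n))$, let $\alpha^{-1}(Q_n)$ be the set of inverse images of elements of $Q_n$, a Kakutani–Rokhlin partition for $(X,\varphi,x_0)$; for a tower $S=(Z_1,\ldots,Z_m)$ of $Q_n$ write $\alpha^{-1}(S)=(\alpha^{-1}(Z_1),\ldots,\alpha^{-1}(Z_m))$. Choose integers $0=f_0\le f_1\le\cdots$, unbounded, with $\alpha^{-1}(Q_n)\le P_{f_n}$ and the top of $\alpha^{-1}(Q_n)$ containing the top of $P_{f_n}$; let $F_n=\{(n,S,T,k):(\alpha^{-1}(S),T,k)\in E(\alpha^{-1}(Q_n),P_{f_n})\}$ with source $(n,S)$, range $(f_n,T)$ and the induced order ($F_0$ a single edge). Then $f=(\bigsqcup F_n,(f_n),\ge)$ is an ordered premorphism $\mathcal{P}(Y,\psi,y_0,(Q_n))\to\mathcal{P}(X,\varphi,x_0,(P_n))$ and $\mathcal{P}(\alpha)=[f]$.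
   Formalization: As stated P(α) need not be a premorphism when α is not onto. Proved: P is full and faithful on surjective morphisms of SDS; also on all morphisms if premorphisms need not have every vertex of V_n as a source; P(α) meets that condition iff α is onto. *)

(* Defs.v *)
From mathcomp Require Import all_boot all_order all_algebra finmap.
From mathcomp Require Import all_classical all_reals all_analysis.

Set Implicit Arguments.
Unset Strict Implicit.
Unset Printing Implicit Defensive.

Local Open Scope classical_set_scope.

(** * Categories and contravariant functors

    Hom-sets are types of representatives: [is_ob] and [is_arr] carve out the
    objects and the representatives of morphisms among raw data, and a morphism
    is an [arr_eq]-class of representatives. *)

Record cat_data := CatData {
  ob : Type;
  is_ob : ob -> Prop;
  arr : ob -> ob -> Type;
  is_arr : forall X Y, arr X Y -> Prop;
  arr_eq : forall X Y, arr X Y -> arr X Y -> Prop;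
  id_arr : forall X, arr X X;
  comp_arr : forall X Y Z, arr Y Z -> arr X Y -> arr X Z }.

Record category (C : cat_data) : Prop := Category {
  id_is_arr : forall X : ob C, is_ob X -> is_arr (id_arr X);
  comp_is_arr : forall (X Y Z : ob C) (g : arr Y Z) (f : arr X Y),
    is_ob X -> is_ob Y -> is_ob Z -> is_arr g -> is_arr f ->
    is_arr (comp_arr g f);
  arr_eq_refl : forall (X Y : ob C) (f : arr X Y),
    is_ob X -> is_ob Y -> is_arr f -> arr_eq f f;
  arr_eq_sym : forall (X Y : ob C) (f g : arr X Y),
    is_ob X -> is_ob Y -> is_arr f -> is_arr g -> arr_eq f g -> arr_eq g f;
  arr_eq_trans : forall (X Y : ob C) (f g h : arr X Y),
    is_ob X -> is_ob Y -> is_arr f -> is_arr g -> is_arr h ->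
    arr_eq f g -> arr_eq g h -> arr_eq f h;
  comp_arr_eq : forall (X Y Z : ob C) (g g' : arr Y Z) (f f' : arr X Y),
    is_ob X -> is_ob Y -> is_ob Z ->
    is_arr g -> is_arr g' -> is_arr f -> is_arr f' ->
    arr_eq g g' -> arr_eq f f' -> arr_eq (comp_arr g f) (comp_arr g' f');
  comp_arrA : forall (X Y Z W : ob C) (h : arr Z W) (g : arr Y Z) (f : arr X Y),
    is_ob X -> is_ob Y -> is_ob Z -> is_ob W ->
    is_arr h -> is_arr g -> is_arr f ->
    arr_eq (comp_arr h (comp_arr g f)) (comp_arr (comp_arr h g) f);
  comp_id_arr : forall (X Y : ob C) (f : arr X Y),
    is_ob X -> is_ob Y -> is_arr f -> arr_eq (comp_arr (id_arr Y) f) f;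
  comp_arr_id : forall (X Y : ob C) (f : arr X Y),
    is_ob X -> is_ob Y -> is_arr f -> arr_eq (comp_arr f (id_arr X)) f }.

(** [farr F a g] reads: [g] is one of the representatives from which the
    morphism [F(a)] is defined, i.e. [F(a)] is the class of [g]. *)
Record contra_data (C D : cat_data) := ContraData {
  fob : ob C -> ob D;
  farr : forall X Y : ob C, arr X Y -> arr (fob Y) (fob X) -> Prop }.

Arguments farr {C D} c {X Y}.

Record contravariant_functor (C D : cat_data) (F : contra_data C D) : Prop :=
  ContravariantFunctor {
  fob_is_ob : forall X : ob C, is_ob X -> is_ob (fob F X);
  farr_ex : forall (X Y : ob C) (a : arr X Y),
    is_ob X -> is_ob Y -> is_arr a -> exists g, farr F a g;
  farr_is_arr : forall (X Y : ob C) (a : arr X Y) g,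
    is_ob X -> is_ob Y -> is_arr a -> farr F a g -> is_arr g;
  farr_eq : forall (X Y : ob C) (a a' : arr X Y) g g',
    is_ob X -> is_ob Y -> is_arr a -> is_arr a' -> arr_eq a a' ->
    farr F a g -> farr F a' g' -> arr_eq g g';
  farr_id : forall (X : ob C) g,
    is_ob X -> farr F (id_arr X) g -> arr_eq g (id_arr (fob F X));
  farr_comp : forall (X Y Z : ob C) (b : arr Y Z) (a : arr X Y) gb ga g,
    is_ob X -> is_ob Y -> is_ob Z -> is_arr b -> is_arr a ->
    farr F b gb -> farr F a ga -> farr F (comp_arr b a) g ->
    arr_eq g (comp_arr ga gb) }.

Definition faithful (C D : cat_data) (F : contra_data C D) : Prop :=
  forall (X Y : ob C) (a a' : arr X Y) g g',
    is_ob X -> is_ob Y -> is_arr a -> is_arr a' ->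
    farr F a g -> farr F a' g' -> arr_eq g g' -> arr_eq a a'.

Definition full (C D : cat_data) (F : contra_data C D) : Prop :=
  forall (X Y : ob C) (g : arr (fob F Y) (fob F X)),
    is_ob X -> is_ob Y -> is_arr g ->
    exists a : arr X Y, is_arr a /\ exists2 g', farr F a g' & arr_eq g' g.

(** * Ordered edge sets *)

Record edge_set (S T : finType) := EdgeSet {
  edge :> finType;
  src : edge -> S;
  rng : edge -> T;
  ele : rel edge }.

(** A partial order for which two edges are comparable iff they have the same
    range; equivalently, a linear order on each fibre of [rng]. *)
Record ordered_edge_set (S T : finType) (F : edge_set S T) : Prop :=
  OrderedEdgeSet {
  ele_refl : reflexive (@ele _ _ F);
  ele_anti : antisymmetric (@ele _ _ F);
  ele_trans : transitive (@ele _ _ F);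
  ele_comparable : forall e e' : F,
    (ele e e' || ele e' e) = (rng e == rng e') }.

Definition src_onto (S T : finType) (F : edge_set S T) : Prop :=
  forall v : S, exists e : F, src e = v.

Definition rng_onto (S T : finType) (F : edge_set S T) : Prop :=
  forall w : T, exists e : F, rng e = w.

Section Compose.
Variables (S T U : finType) (F : edge_set S T) (G : edge_set T U).

Definition ecomp_edge := {p : F * G | rng p.1 == src p.2}.

Definition ecomp : edge_set S U :=
  @EdgeSet S U ecomp_edge
    (fun p => src (val p).1)
    (fun p => rng (val p).2)
    (fun p q => (((val p).2 != (val q).2) && ele (val p).2 (val q).2)
             || (((val p).2 == (val q).2) && ele (val p).1 (val q).1)).

End Compose.

Definition eiso (S T : finType) (F G : edge_set S T) : Prop :=
  exists h : F -> G,
    [/\ bijective h,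
        forall e, src (h e) = src e,
        forall e, rng (h e) = rng e &
        forall e e', ele (h e) (h e') = ele e e'].

(** * Ordered Bratteli diagrams

    [E B n] is the edge set usually written E_{n+1}, from V_n to V_{n+1}. *)

Record obd_data := ObdData {
  V : nat -> finType;
  E : forall n, edge_set (V n) (V n.+1) }.

Record is_obd (B : obd_data) : Prop := IsObd {
  obd_V0 : #|V B 0| = 1;
  obd_V : forall n, 0 < #|V B n|;
  obd_E : forall n, 0 < #|E B n|;
  obd_order : forall n, ordered_edge_set (E B n);
  obd_src : forall n, src_onto (E B n);
  obd_rng : forall n, rng_onto (E B n) }.

(** One edge from [v] to [v] for each vertex [v] when [k = l] (no edge when
    [k != l]); indexing by both [k] and [l] avoids transports along [k = l]. *)
Definition ediag (B : obd_data) (k l : nat) : edge_set (V B k) (V B l) :=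
  @EdgeSet (V B k) (V B l)
    {p : V B k * V B l | Tagged (V B) p.1 == Tagged (V B) p.2}
    (fun p => (val p).1) (fun p => (val p).2) eq_op.

(** E_{k,l} for [k <= l]. A trivial factor E_{k,k} is kept in front, which does
    not matter up to [eiso]; for [l < k] there is no edge. *)
Fixpoint epath (B : obd_data) (k l : nat) : edge_set (V B k) (V B l) :=
  match l with
  | 0 => ediag B k 0
  | l'.+1 => if k <= l' then ecomp (epath B k l') (E B l')
             else ediag B k l'.+1
  end.

Record premor (B C : obd_data) := Premor {
  pidx : nat -> nat;
  pedge : forall n, edge_set (V B n) (V C (pidx n)) }.

(** All the conditions on an ordered premorphism except that every vertex of
    the domain be the source of an edge. *)
Record is_weak_premor (B C : obd_data) (f : premor B C) : Prop := IsWeakPremor {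
  pidx0 : pidx f 0 = 0;
  pidx_mono : forall n, pidx f n <= pidx f n.+1;
  pidx_unbounded : forall N, exists n, N <= pidx f n;
  pedge0 : #|pedge f 0| = 1;
  pedge_nonempty : forall n, 0 < #|pedge f n|;
  pedge_order : forall n, ordered_edge_set (pedge f n);
  pedge_rng : forall n, rng_onto (pedge f n);
  pedge_comm : forall n,
    eiso (ecomp (E B n) (pedge f n.+1))
         (ecomp (pedge f n) (epath C (pidx f n) (pidx f n.+1))) }.

Definition premor_src_onto (B C : obd_data) (f : premor B C) : Prop :=
  forall n, src_onto (pedge f n).

Definition is_premor (B C : obd_data) (f : premor B C) : Prop :=
  is_weak_premor f /\ premor_src_onto f.

Definition premor_equiv (B C : obd_data) (f g : premor B C) : Prop :=
  exists n m : nat -> nat, 0 < n 0 /\ forall k,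
    [/\ n k < m k < n k.+1,
        pidx f (n k) < pidx g (m k) < pidx f (n k.+1),
        eiso (ecomp (epath B (n k) (m k)) (pedge g (m k)))
             (ecomp (pedge f (n k)) (epath C (pidx f (n k)) (pidx g (m k)))) &
        eiso (ecomp (epath B (m k) (n k.+1)) (pedge f (n k.+1)))
             (ecomp (pedge g (m k))
                    (epath C (pidx g (m k)) (pidx f (n k.+1))))].

Definition premor_id (B : obd_data) : premor B B :=
  @Premor B B id (fun n => ediag B n n).

Definition premor_comp (B C D : obd_data) (g : premor C D) (f : premor B C) :
    premor B D :=
  @Premor B D (fun n => pidx g (pidx f n))
    (fun n => ecomp (pedge f n) (pedge g (pidx f n))).

Definition OBD : cat_data :=
  @CatData obd_data is_obd premor is_premor premor_equiv premor_id premor_comp.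

Definition OBD_weak : cat_data :=
  @CatData obd_data is_obd premor is_weak_premor premor_equiv
    premor_id premor_comp.

(** * Essentially minimal totally disconnected dynamical systems *)

Definition homeomorphism (X Y : topologicalType) (h : X -> Y) : Prop :=
  continuous h /\
  exists g : Y -> X, [/\ cancel h g, cancel g h & continuous g].

Definition metrizable (R : realType) (X : topologicalType) : Prop :=
  exists (M : metricType R) (h : X -> M), homeomorphism h.

Section KakutaniRokhlin.
Variables (X : topologicalType) (phi : X -> X) (x0 : X).

Definition minimal_set (M : set X) : Prop :=
  [/\ M !=set0, closed M, phi @` M = M &
      forall A : set X, A !=set0 -> closed A -> phi @` A = A ->
        A `<=` M -> A = M].

(** A tower (Z(k,1), ..., Z(k,J(k))) is the sequence of its floors, and a
    partition with its tower structure is the finite set of its towers. *)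
Definition tower := seq (set X).
Definition tower_family := {fset tower}.

Definition floors (P : tower_family) : set (set X) :=
  [set A | exists2 S : tower, S \in P & A \in S].

Definition top (P : tower_family) : set X :=
  [set x | exists2 S : tower, S \in P & last set0 S x].

Definition bottom (P : tower_family) : set X :=
  [set x | exists2 S : tower, S \in P & head set0 S x].

Record kr_partition (P : tower_family) : Prop := KrPartition {
  kr_tower : forall S : tower, S \in P -> 0 < size S;
  kr_nonempty : forall A, floors P A -> A !=set0;
  kr_clopen : forall A, floors P A -> clopen A;
  kr_cover : \bigcup_(A in floors P) A = setT;
  kr_disjoint : forall (S T : tower) (i j : nat), S \in P -> T \in P ->
    i < size S -> j < size T ->
    nth set0 S i `&` nth set0 T j !=set0 -> S = T /\ i = j;
  kr_next : forall (S : tower) (j : nat), S \in P -> j.+1 < size S ->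
    phi @` nth set0 S j = nth set0 S j.+1;
  kr_x0 : top P x0;
  kr_top : phi @` top P = bottom P }.

(** [P <= Q]: [Q] refines [P]. *)
Definition refined_by (P Q : tower_family) : Prop :=
  forall B, floors Q B -> exists2 A, floors P A & B `<=` A.

Record kr_system (P : nat -> tower_family) : Prop := KrSystem {
  krs_partition : forall n, kr_partition (P n);
  krs_0 : P 0 = [fset [:: setT]]%fset;
  krs_refine : forall n, refined_by (P n) (P n.+1);
  krs_top : forall n, 0 < n -> top (P n.+1) `<=` top (P n);
  krs_cap : \bigcap_(n in [set n | 0 < n]) top (P n) = [set x0];
  krs_basis : basis (\bigcup_(n in setT) floors (P n)) }.

(** Floors are numbered from 0 here, so the shift [k] is the same integer as
    with floors numbered from 1. *)
Definition occurs_at (S T : tower) (k : nat) : bool :=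
  (k + size S <= size T) &&
  `[< forall j, j < size S -> nth set0 T (k + j) `<=` nth set0 S j >].

(** The triples (S,T,k), where [S] ranges over an index set [I] for the towers
    [tw S], and [T] over the towers of [Q]. *)
Definition tower_edges (I : finType) (tw : I -> tower) (Q : tower_family) :
    edge_set I Q :=
  @EdgeSet I Q
    {p : I * {T : Q & 'I_(size (val T)).+1} |
       occurs_at (tw p.1) (val (tag p.2)) (tagged p.2)}
    (fun p => (val p).1)
    (fun p => tag (val p).2)
    (fun p q => (tag (val p).2 == tag (val q).2)
             && (tagged (val p).2 <= tagged (val q).2)).

Definition kr_edges (P Q : tower_family) : edge_set P Q :=
  tower_edges (fun S : P => val S) Q.

End KakutaniRokhlin.

Record sds (R : realType) := Sds {
  space :> topologicalType;
  shift : space -> space;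
  base : space;
  parts : nat -> tower_family space;
  sds_metrizable : metrizable R space;
  sds_compact : compact [set: space];
  sds_disconnected : totally_disconnected [set: space];
  sds_homeo : homeomorphism shift;
  sds_minimal : exists M : set space,
    [/\ minimal_set shift M,
        forall M', minimal_set shift M' -> M' = M & M base];
  sds_kr : kr_system shift base parts }.

Definition is_sds_mor (R : realType) (X Y : sds R) (a : X -> Y) : Prop :=
  [/\ continuous a,
      forall x, a (shift x) = shift (a x) &
      a (base X) = base Y].

Definition onto (X Y : Type) (a : X -> Y) : Prop := forall y, exists x, a x = y.

Definition SDS (R : realType) : cat_data :=
  @CatData (sds R) (fun=> True) (fun X Y => X -> Y) (@is_sds_mor R)
    (fun X Y a b => a =1 b) (fun X => idfun) (fun X Y Z b a => b \o a).

(** Same objects; surjective morphisms only. *)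
Definition SDS_onto (R : realType) : cat_data :=
  @CatData (sds R) (fun=> True) (fun X Y => X -> Y)
    (fun X Y a => is_sds_mor a /\ onto a)
    (fun X Y a b => a =1 b) (fun X => idfun) (fun X Y Z b a => b \o a).

(** * The functor *)

Definition P_ob (R : realType) (X : sds R) : obd_data :=
  @ObdData (fun n => parts X n : finType)
    (fun n => kr_edges (parts X n) (parts X n.+1)).

Definition pre_tower (X Y : topologicalType) (a : X -> Y) (S : tower Y) :
    tower X :=
  [seq a @^-1` A | A <- S].

Definition pre_family (X Y : topologicalType) (a : X -> Y)
    (Q : tower_family Y) : tower_family X :=
  [fset pre_tower a S | S in Q]%fset.

(** The sequences (f_n) which may be chosen to define the image of [a]. *)
Definition admissible (R : realType) (X Y : sds R) (a : X -> Y)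
    (f : nat -> nat) : Prop :=
  [/\ f 0 = 0,
      forall n, f n <= f n.+1,
      forall N, exists n, N <= f n &
      forall n, refined_by (pre_family a (parts Y n)) (parts X (f n)) /\
                top (parts X (f n)) `<=` top (pre_family a (parts Y n))].

Definition P_premor (R : realType) (X Y : sds R) (a : X -> Y) (f : nat -> nat) :
    premor (P_ob Y) (P_ob X) :=
  @Premor (P_ob Y) (P_ob X) f
    (fun n => tower_edges (fun S : parts Y n => pre_tower a (val S))
                          (parts X (f n))).

Definition P_arr (R : realType) (X Y : sds R) (a : X -> Y)
    (g : premor (P_ob Y) (P_ob X)) : Prop :=
  exists2 f, admissible a f & g = P_premor a f.

(** A morphism [a] : X -> Y of SDS need not be onto: map a point to the fixed
    point at infinity of the one-point compactification of the integers with
    the shift. The sets in the inverse image of a partition of Y may then be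
    empty, and the towers of Y missed by [a] are the source of no edge in
    [P_premor a f]. Hence the image of [a] is a morphism of OBD for [a] onto,
    and in general it is a morphism of OBD_weak. *)
Definition P_onto (R : realType) : contra_data (SDS_onto R) OBD :=
  @ContraData (SDS_onto R) OBD (@P_ob R) (@P_arr R).

Definition P_all (R : realType) : contra_data (SDS R) OBD_weak :=
  @ContraData (SDS R) OBD_weak (@P_ob R) (@P_arr R).

(* Main.v *)
Require Import Defs.
From mathcomp Require Import all_boot all_order all_algebra finmap.
From mathcomp Require Import all_classical all_reals all_analysis.
(* Imported again so that [top] and [bottom] are those of a partition. *)
Import Defs.

Set Implicit Arguments.
Unset Strict Implicit.
Unset Printing Implicit Defensive.

Local Open Scope classical_set_scope.

(** Why the functor is full and faithful.

    A morphism [a] is determined by its codes: for each level [n], the tower of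
    [Y] and the height in it at which [a x] lies, as a function of the floor of
    a fine enough partition of [X] that contains [x]. A tower [T] of [X] is cut
    by the inverse images of the towers of [Y] into consecutive blocks, and the
    edges of [P_premor a f] into [T] list these blocks in order. Since the height
    of each block is that of its tower, the list of sources alone determines
    where each block starts: the block of an edge [e] starts at the sum [offset e]
    of the heights of the sources of the edges before [e]
    ([offset_tower_edges]). Order isomorphisms preserve offsets.

    Functoriality rests on one computation, [tower_edges_comp]: an occurrence at
    height [k] of [S] in [T] and one at height [l] of [T] in [U] compose to an
    occurrence at height [l + k] of [S] in [U], and each occurrence of [S] in
    [U] arises so exactly once. It gives the commuting squares of
    [P_premor a f], the independence of the sequence [f] and the compatibility
    with composition. To treat inverse images under maps that are not onto, whose
    floors may be empty, it is proved for indexed families of towers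
    ([tower_system]).

    Equivalence of premorphisms is handled through commuting squares between a
    level of one premorphism and a level of the other ([compat]): these can be
    pasted, and two premorphisms are equivalent iff from every level of each
    there is a commuting square to every high enough level of the other
    ([premor_equivP]).

    Faithfulness: if [P_premor a f] and [P_premor a' f'] are equivalent, then
    some partition of [X] refines the inverse images under [a] and [a'] of any
    given partition of [Y], with isomorphic edge sets. The blocks then start at
    the same heights, so [a x] and [a' x] lie in the same floors at all levels.

    Fullness: given a premorphism [g], the commuting squares show by induction
    that the heights of the sources of the edges into a tower [T] of [X] add up to
    the height of [T] ([fibre_length_pedge]), so that these edges cut [T] into
    blocks. This gives each point [x] a code at each level. The commuting squares
    also show that the floors named by the codes of [x] decrease ([code_down]);
    by compactness they share a point, which is unique since floors separate
    points, and [a x] is that point. It commutes with the shifts: when the code of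
    [x] is below the top at some level, both [a (shift x)] and [shift (a x)] lie
    one floor above [a x] from that level on; when it is at the top at all levels,
    [a x] is the base point, and both points lie in every bottom.

    Finally the edges of [P_premor a f] see exactly the floors that meet the
    image of [a], which is compact; hence the condition on sources holds iff [a]
    is onto, and the statement for onto maps follows from the general one. *)

(** * Ordered edge sets up to isomorphism *)

Section EdgeSetIso.
Variables S T : finType.
Implicit Types F G H : edge_set S T.

Lemma eiso_refl F : eiso F F.
Proof. by exists id; split=> //; exists id. Qed.

Lemma eiso_sym F G : eiso F G -> eiso G F.
Proof.
case=> h [[g hK gK] hs hr he]; exists g; split; first by exists h.
- by move=> e; rewrite -hs gK.
- by move=> e; rewrite -hr gK.
- by move=> e e'; rewrite -he !gK.
Qed.

Lemma eiso_trans G F H : eiso F G -> eiso G H -> eiso F H.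
Proof.
case=> h [hb hs hr he] [k [kb ks kr ke]]; exists (k \o h); split.
- exact: bij_comp.
- by move=> e /=; rewrite ks.
- by move=> e /=; rewrite kr.
- by move=> e e' /=; rewrite ke.
Qed.

Lemma eiso_inj_surj F G (h : F -> G) :
  injective h -> (forall e, exists d, h d = e) ->
  (forall e, src (h e) = src e) -> (forall e, rng (h e) = rng e) ->
  (forall e e', ele (h e) (h e') = ele e e') -> eiso F G.
Proof.
move=> hi hsur hs hr he; exists h; split=> //.
have [g gP] := choice hsur.
by exists g => e; [apply: hi; rewrite gP | rewrite gP].
Qed.

Lemma ele_eq F (oF : ordered_edge_set F) (e e' : F) :
  ele e e' -> ele e' e -> e = e'.
Proof. by move=> h1 h2; apply: (ele_anti oF); rewrite h1 h2. Qed.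

Lemma ele_rng F (oF : ordered_edge_set F) (e e' : F) :
  ele e e' -> rng e = rng e'.
Proof. by move=> h; apply/eqP; rewrite -(ele_comparable oF) h. Qed.

(** Between ordered edge sets, a correspondence that is total on both sides and
    respects sources, ranges and order is the graph of an isomorphism:
    antisymmetry makes it single-valued and injective. *)
Lemma eiso_rel F G (K : F -> G -> Prop) :
  ordered_edge_set F -> ordered_edge_set G ->
  (forall e, exists d, K e d) -> (forall d, exists e, K e d) ->
  (forall e d, K e d -> src e = src d) ->
  (forall e d, K e d -> rng e = rng d) ->
  (forall e d e' d', K e d -> K e' d' -> ele e e' = ele d d') -> eiso F G.
Proof.
move=> oF oG tF tG Ks Kr Ke; have [h hK] := choice tF.
apply: (@eiso_inj_surj _ _ h).
- move=> e e' hee; apply: (ele_eq oF).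
    by rewrite (Ke _ _ _ _ (hK e) (hK e')) hee (ele_refl oG).
  by rewrite (Ke _ _ _ _ (hK e') (hK e)) hee (ele_refl oG).
- move=> d; have [e ed] := tG d; exists e; apply: (ele_eq oG).
    by rewrite -(Ke _ _ _ _ (hK e) ed) (ele_refl oF).
  by rewrite -(Ke _ _ _ _ ed (hK e)) (ele_refl oF).
- by move=> e; rewrite (Ks _ _ (hK e)).
- by move=> e; rewrite (Kr _ _ (hK e)).
- by move=> e e'; rewrite (Ke _ _ _ _ (hK e) (hK e')).
Qed.

Lemma eiso_src_onto F G : eiso F G -> src_onto F -> src_onto G.
Proof.
by case=> h [_ hs _ _] oF v; have [e <-] := oF v; exists (h e).
Qed.

End EdgeSetIso.

Section Composite.
Variables (S T U : finType) (F : edge_set S T) (G : edge_set T U).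

(** The two factors of an edge of a composite, and the edge they form. *)
Definition efst (p : ecomp F G) : F := (val (p : ecomp_edge F G)).1.
Definition esnd (p : ecomp F G) : G := (val (p : ecomp_edge F G)).2.

Lemma ecomp_mid (p : ecomp F G) : rng (efst p) = src (esnd p).
Proof. exact/eqP/(valP (p : ecomp_edge F G)). Qed.

Lemma ecomp_ext (p q : ecomp F G) : efst p = efst q -> esnd p = esnd q -> p = q.
Proof.
rewrite /efst /esnd => h1 h2; apply: (@val_inj _ _ (ecomp_edge F G)).
by rewrite [LHS]surjective_pairing [RHS]surjective_pairing h1 h2.
Qed.

Definition epair (e : F) (g : G) (h : rng e = src g) : ecomp F G :=
  exist (fun p : F * G => rng p.1 == src p.2) (e, g) (introT eqP h).

Lemma efst_pair e g h : efst (@epair e g h) = e. Proof. by []. Qed.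
Lemma esnd_pair e g h : esnd (@epair e g h) = g. Proof. by []. Qed.

Lemma src_ecomp (p : ecomp F G) : src p = src (efst p). Proof. by []. Qed.
Lemma rng_ecomp (p : ecomp F G) : rng p = rng (esnd p). Proof. by []. Qed.

Lemma ele_ecomp (p q : ecomp F G) :
  ele p q = ((esnd p != esnd q) && ele (esnd p) (esnd q))
         || ((esnd p == esnd q) && ele (efst p) (efst q)).
Proof. by []. Qed.

Lemma ele_ecomp_same (p q : ecomp F G) :
  esnd p = esnd q -> ele p q = ele (efst p) (efst q).
Proof. by move=> e; rewrite ele_ecomp e eqxx. Qed.

Lemma ele_ecomp_diff (p q : ecomp F G) :
  esnd p <> esnd q -> ele p q = ele (esnd p) (esnd q).
Proof. by move=> /eqP ne; rewrite ele_ecomp ne (negbTE ne) orbF. Qed.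

Lemma ecomp_eqE (p q : ecomp F G) :
  (p == q) = (efst p == efst q) && (esnd p == esnd q).
Proof.
apply/eqP/andP => [-> // | [/eqP h1 /eqP h2]].
exact: ecomp_ext.
Qed.

Lemma ecomp_order :
  ordered_edge_set F -> ordered_edge_set G -> ordered_edge_set (ecomp F G).
Proof.
move=> oF oG; split.
- by move=> p; rewrite ele_ecomp eqxx (ele_refl oF).
- move=> p q; rewrite !ele_ecomp.
  case: (eqVneq (esnd p) (esnd q)) => [e|ne] /=.
    by move=> /(ele_anti oF) e1; exact: ecomp_ext.
  by rewrite !orbF => /(ele_anti oG) e; rewrite e eqxx in ne.
- move=> q p r; rewrite !ele_ecomp.
  case: (eqVneq (esnd p) (esnd q)) => [<-|pq] /=.
    case: (eqVneq (esnd p) (esnd r)) => [<-|//] /=.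
    exact: (ele_trans oF).
  rewrite orbF => pq'; case: (eqVneq (esnd q) (esnd r)) => [<-|qr] /=.
    by rewrite pq pq'.
  rewrite orbF => qr'; have pr' := ele_trans oG pq' qr'.
  case: eqVneq => [pr|] /=; last by rewrite pr'.
  by rewrite pr in pq pq'; rewrite (ele_eq oG pq' qr') eqxx in pq.
- move=> p q; rewrite !ele_ecomp !rng_ecomp.
  case: (eqVneq (esnd p) (esnd q)) => [e|ne] /=.
    by rewrite (ele_comparable oF) !ecomp_mid e !eqxx.
  by rewrite !orbF (ele_comparable oG).
Qed.

Lemma ecomp_src_onto : src_onto F -> src_onto G -> src_onto (ecomp F G).
Proof.
move=> oF oG v; have [e ev] := oF v; have [g ge] := oG (rng e).
by exists (epair (esym ge)).
Qed.

Lemma ecomp_rng_onto : rng_onto F -> rng_onto G -> rng_onto (ecomp F G).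
Proof.
move=> oF oG v; have [g gv] := oG v; have [e eg] := oF (src g).
by exists (epair eg).
Qed.

End Composite.

Lemma ecomp_eiso (S T U : finType) (F F' : edge_set S T) (G G' : edge_set T U) :
  eiso F F' -> eiso G G' -> eiso (ecomp F G) (ecomp F' G').
Proof.
case=> h [[h' hK h'K] hs hr he] [k [[k' kK k'K] ks kr ke]].
have hk (p : ecomp F G) : rng (h (efst p)) = src (k (esnd p)).
  by rewrite hr ks ecomp_mid.
apply: (@eiso_inj_surj _ _ _ _ (fun p => epair (hk p))).
- move=> p q e.
  have /(can_inj hK) e1 : h (efst p) = h (efst q) by rewrite -(efst_pair (hk p)) e.
  have /(can_inj kK) e2 : k (esnd p) = k (esnd q) by rewrite -(esnd_pair (hk p)) e.
  exact: ecomp_ext.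
- move=> q; have kh : rng (h' (efst q)) = src (k' (esnd q)).
    by rewrite -hr -ks h'K k'K ecomp_mid.
  by exists (epair kh); apply: ecomp_ext; rewrite ?efst_pair ?esnd_pair ?h'K ?k'K.
- by move=> p; rewrite !src_ecomp efst_pair hs.
- by move=> p; rewrite !rng_ecomp esnd_pair kr.
- move=> p q; rewrite !ele_ecomp !efst_pair !esnd_pair he ke.
  by rewrite !(inj_eq (can_inj kK)).
Qed.

Lemma ecompA (S T U W : finType) (F : edge_set S T) (G : edge_set T U)
    (H : edge_set U W) :
  eiso (ecomp (ecomp F G) H) (ecomp F (ecomp G H)).
Proof.
have m1 (p : ecomp (ecomp F G) H) : rng (esnd (efst p)) = src (esnd p).
  exact: ecomp_mid p.
have m2 (p : ecomp (ecomp F G) H) : rng (efst (efst p)) = src (epair (m1 p)).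
  exact: ecomp_mid (efst p).
apply: (@eiso_inj_surj _ _ _ _ (fun p => epair (m2 p))).
- move=> p q e.
  have e1 : efst (efst p) = efst (efst q) by rewrite -(efst_pair (m2 p)) e.
  have e2 : epair (m1 p) = epair (m1 q) by rewrite -(esnd_pair (m2 p)) e.
  apply: ecomp_ext; first apply: ecomp_ext => //.
    by rewrite -(efst_pair (m1 p)) e2.
  by rewrite -(esnd_pair (m1 p)) e2.
- move=> q.
  have n1 : rng (efst q) = src (efst (esnd q)) by exact: ecomp_mid q.
  have n2 : rng (epair n1) = src (esnd (esnd q)).
    by rewrite rng_ecomp esnd_pair ecomp_mid.
  by exists (epair n2); apply: ecomp_ext => //; apply: ecomp_ext.
- by [].
- by [].
- move=> p q; rewrite !ele_ecomp !ecomp_eqE !efst_pair !esnd_pair ?ele_ecomp.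
  by do ![case: eqP => _ //=]; rewrite ?orbF.
Qed.

(** * Paths in ordered Bratteli diagrams *)

Section Paths.
Variable B : obd_data.

Lemma ediagP k (p : ediag B k k) : src p = rng p.
Proof.
by case: p => -[v w] /=; rewrite eq_Tagged /= => /eqP.
Qed.

Lemma ediag_ext k (p q : ediag B k k) : src p = src q -> p = q.
Proof.
move=> h; have h' : rng p = rng q by rewrite -!ediagP.
case: p q h h' => -[v w] /= h [[v' w'] h'] /= e e'; subst.
by congr exist; exact: bool_irrelevance.
Qed.

Lemma ediag_ex k (v : V B k) : exists p : ediag B k k, src p = v /\ rng p = v.
Proof.
have h : Tagged (V B) v == Tagged (V B) v by rewrite eqxx.
by exists (exist (fun p : V B k * V B k => Tagged (V B) p.1 == Tagged (V B) p.2)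
  (v, v) h).
Qed.

Lemma ele_ediag k l (p q : ediag B k l) : ele p q = (p == q).
Proof. by []. Qed.

Lemma ediag_order k : ordered_edge_set (ediag B k k).
Proof.
split.
- by move=> p; rewrite ele_ediag.
- by move=> p q; rewrite ele_ediag => /andP[/eqP].
- by move=> q p r; rewrite !ele_ediag => /eqP-> /eqP->.
- move=> p q; rewrite !ele_ediag eq_sym orbb.
  by apply/eqP/eqP => [-> //|h]; apply: ediag_ext; rewrite !ediagP.
Qed.

Lemma ecomp1e k (T : finType) (F : edge_set (V B k) T) :
  ordered_edge_set F -> eiso (ecomp (ediag B k k) F) F.
Proof.
move=> oF.
apply: (@eiso_rel _ _ _ _ (fun p e => esnd p = e)) => //.
- exact: ecomp_order (ediag_order k) oF.
- by move=> p; exists (esnd p).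
- move=> e; have [p [_ pr]] := ediag_ex (src e).
  by exists (epair pr).
- by move=> p _ <-; rewrite src_ecomp ediagP ecomp_mid.
- by move=> p _ <-.
- move=> p _ q _ <- <-; rewrite ele_ecomp ele_ediag.
  case: eqVneq => [e|//] /=; last by rewrite orbF.
  rewrite e (ele_refl oF); apply/eqP/ediag_ext.
  by rewrite !ediagP !ecomp_mid e.
Qed.

Lemma ecompe1 k (S : finType) (F : edge_set S (V B k)) :
  ordered_edge_set F -> eiso (ecomp F (ediag B k k)) F.
Proof.
move=> oF.
apply: (@eiso_rel _ _ _ _ (fun p e => efst p = e)) => //.
- exact: ecomp_order oF (ediag_order k).
- by move=> p; exists (efst p).
- move=> e; have [p [ps _]] := ediag_ex (rng e).
  by exists (epair (esym ps)).
- by move=> p _ <-.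
- by move=> p _ <-; rewrite rng_ecomp -ediagP ecomp_mid.
- move=> p _ q _ <- <-; rewrite ele_ecomp ele_ediag.
  case: eqVneq => [//|/eqP ne] /=; apply/esym/negP => /(ele_rng oF) h.
  by apply: ne; apply: ediag_ext; rewrite -!ecomp_mid.
Qed.

Lemma epath_diag k : epath B k k = ediag B k k.
Proof. by case: k => [|k] //=; rewrite ltnn. Qed.

Lemma epathS k l : k <= l -> epath B k l.+1 = ecomp (epath B k l) (E B l).
Proof. by move=> /= ->. Qed.

Hypothesis oB : is_obd B.

Lemma epath_order k l : k <= l -> ordered_edge_set (epath B k l).
Proof.
elim: l => [|l IH]; first by rewrite leqn0 => /eqP ->; exact: ediag_order.
rewrite leq_eqVlt => /predU1P[->|]; first by rewrite epath_diag; exact: ediag_order.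
rewrite ltnS => kl; rewrite epathS//.
by apply: ecomp_order; [exact: IH | exact: (obd_order oB)].
Qed.

Lemma epath_cat k l m : k <= l -> l <= m ->
  eiso (ecomp (epath B k l) (epath B l m)) (epath B k m).
Proof.
move=> kl; elim: m => [|m IH].
  rewrite leqn0 => /eqP l0; subst l.
  by apply: ecompe1; exact: epath_order.
rewrite leq_eqVlt => /predU1P[lm|].
  subst l; rewrite (epath_diag m.+1); apply: ecompe1; exact: epath_order.
rewrite ltnS => lm; rewrite !epathS//; last exact: leq_trans lm.
apply: eiso_trans (eiso_sym (ecompA _ _ _)) _.
by apply: ecomp_eiso; [exact: IH | exact: eiso_refl].
Qed.

Lemma epath1 k : eiso (epath B k k.+1) (E B k).
Proof.
rewrite epathS// epath_diag; apply: ecomp1e; exact: (obd_order oB).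
Qed.

End Paths.

(** * Equivalence of premorphisms *)

Section Premorphisms.
Variables B C : obd_data.
Implicit Types f g h : premor B C.

(** The square between level [n] of [f] and level [m] of [g] commutes. *)
Definition compat f g (n m : nat) : Prop :=
  [/\ n <= m, pidx f n <= pidx g m &
      eiso (ecomp (epath B n m) (pedge g m))
           (ecomp (pedge f n) (epath C (pidx f n) (pidx g m)))].

(** From each level of [f] there are commuting squares to all high enough
    levels of [g]. *)
Definition eventually_compat f g : Prop :=
  forall n, exists M, forall m, M <= m -> compat f g n m.

Lemma pidx_le f n m : is_weak_premor f -> n <= m -> pidx f n <= pidx f m.
Proof.
move=> wf; elim: m => [|m IH]; first by rewrite leqn0 => /eqP ->.
rewrite leq_eqVlt => /predU1P[-> //|]; rewrite ltnS => /IH h.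
exact: leq_trans h (pidx_mono wf m).
Qed.

Lemma pidx_large f N : is_weak_premor f -> exists M, forall m, M <= m -> N <= pidx f m.
Proof.
move=> wf; have [M NM] := pidx_unbounded wf N; exists M => m Mm.
exact: leq_trans NM (pidx_le wf Mm).
Qed.

Hypotheses (oB : is_obd B) (oC : is_obd C).

Lemma compat_self f n m : is_weak_premor f -> n <= m -> compat f f n m.
Proof.
move=> wf nm; split=> //; first exact: pidx_le.
elim: m nm => [|m IH].
  rewrite leqn0 => /eqP -> {n}; rewrite !epath_diag.
  apply: (@eiso_trans _ _ (pedge f 0)).
    exact: ecomp1e (pedge_order wf 0).
  exact/eiso_sym/ecompe1/(pedge_order wf 0).
rewrite leq_eqVlt => /predU1P[nm|].
  subst n; rewrite !epath_diag; apply: (@eiso_trans _ _ (pedge f m.+1)).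
    exact: ecomp1e (pedge_order wf _).
  exact/eiso_sym/ecompe1/(pedge_order wf _).
rewrite ltnS => nm; rewrite epathS//.
apply: eiso_trans (ecompA _ _ _) _.
apply: eiso_trans (ecomp_eiso (eiso_refl _) (pedge_comm wf m)) _.
apply: eiso_trans (eiso_sym (ecompA _ _ _)) _.
apply: eiso_trans (ecomp_eiso (IH nm) (eiso_refl _)) _.
apply: eiso_trans (ecompA _ _ _) _.
apply: ecomp_eiso (eiso_refl _) _.
by apply: epath_cat => //; apply: pidx_le => //; exact: leqnSn.
Qed.

Lemma compat_trans g f h n m p : compat f g n m -> compat g h m p -> compat f h n p.
Proof.
move=> [nm fg e1] [mp gh e2]; split; [exact: leq_trans mp|exact: leq_trans gh|].
apply: eiso_trans (ecomp_eiso (eiso_sym (epath_cat oB nm mp)) (eiso_refl _)) _.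
apply: eiso_trans (ecompA _ _ _) _.
apply: eiso_trans (ecomp_eiso (eiso_refl _) e2) _.
apply: eiso_trans (eiso_sym (ecompA _ _ _)) _.
apply: eiso_trans (ecomp_eiso e1 (eiso_refl _)) _.
apply: eiso_trans (ecompA _ _ _) _.
exact: ecomp_eiso (eiso_refl _) (epath_cat oC fg gh).
Qed.

(** Commuting squares along one interleaved pair of sequences give commuting
    squares from every level to all sufficiently high levels, and conversely:
    squares can be pasted with those of [f] and [g] themselves. *)
Lemma premor_equivP f g : is_weak_premor f -> is_weak_premor g ->
  premor_equiv f g <-> eventually_compat f g /\ eventually_compat g f.
Proof.
move=> wf wg; split.
  case=> n [m [n0 H]].
  have nk k : k <= n k.
    elim: k => [//|k IH]; have [/andP[h1 h2] _ _ _] := H k.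
    exact: leq_ltn_trans IH (ltn_trans h1 h2).
  split=> k.
    exists (m k) => p kp.
    have [/andP[h1 h2] /andP[h3 h4] h5 _] := H k.
    apply: (compat_trans (compat_self wf (nk k))).
    by apply: compat_trans (compat_self wg kp); split=> //; exact: ltnW.
  exists (n k.+1) => p kp.
  have [/andP[h1 h2] /andP[h3 h4] _ h5] := H k.
  have km : k <= m k by exact: leq_trans (nk k) (ltnW h1).
  apply: (compat_trans (compat_self wg km)).
  by apply: compat_trans (compat_self wf kp); split=> //; exact: ltnW.
case=> fg gf.
have next f' g' : is_weak_premor f' -> is_weak_premor g' ->
    eventually_compat f' g' -> forall n, exists m,
      [/\ n < m, pidx f' n < pidx g' m & compat f' g' n m].
  move=> wf' wg' fg' n; have [M MP] := fg' n.
  have [N NP] := pidx_large (pidx f' n).+1 wg'.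
  exists (maxn n.+1 (maxn M N)); split.
  - by rewrite leq_max leqnn.
  - by apply: NP; rewrite !leq_max leqnn !orbT.
  - by apply: MP; rewrite !leq_max leqnn orbT.
have [up upP] := choice (next f g wf wg fg).
have [dn dnP] := choice (next g f wg wf gf).
pose n k := iter k (fun i => dn (up i)) 1.
exists n, (fun k => up (n k)); split=> // k /=.
have [h1 h2 [_ _ h3]] := upP (n k).
have [h4 h5 [_ _ h6]] := dnP (up (n k)).
by split; rewrite ?h1 ?h2.
Qed.

Lemma eventually_compat_trans g f h : is_weak_premor g ->
  eventually_compat f g -> eventually_compat g h -> eventually_compat f h.
Proof.
move=> wg fg gh n; have [M MP] := fg n; have [N NP] := gh M.
by exists N => m Nm; apply: (compat_trans (MP M (leqnn _))); exact: NP.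
Qed.

Lemma eventually_compat_self f : is_weak_premor f -> eventually_compat f f.
Proof. by move=> wf n; exists n => m; exact: compat_self. Qed.

Lemma premor_equiv_refl f : is_weak_premor f -> premor_equiv f f.
Proof.
by move=> wf; apply/premor_equivP => //; split; exact: eventually_compat_self.
Qed.

Lemma premor_equiv_sym f g : is_weak_premor f -> is_weak_premor g ->
  premor_equiv f g -> premor_equiv g f.
Proof.
by move=> wf wg /(premor_equivP wf wg)[h1 h2]; apply/premor_equivP.
Qed.

Lemma premor_equiv_trans f g h :
  is_weak_premor f -> is_weak_premor g -> is_weak_premor h ->
  premor_equiv f g -> premor_equiv g h -> premor_equiv f h.
Proof.
move=> wf wg wh /(premor_equivP wf wg)[h1 h2] /(premor_equivP wg wh)[h3 h4].
by apply/premor_equivP => //; split; exact: (@eventually_compat_trans g).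
Qed.

(** A commuting square of [f] with level [m] of [g] that starts at level [m] of
    [f] gives one that starts at any lower level. *)
Lemma compat_iso f g n m : is_weak_premor f -> n <= m ->
  pidx f m <= pidx g m ->
  eiso (pedge g m) (ecomp (pedge f m) (epath C (pidx f m) (pidx g m))) ->
  compat f g n m.
Proof.
move=> wf nm fg e; apply: (compat_trans (compat_self wf nm)); split=> //.
rewrite epath_diag; apply: eiso_trans (e).
apply: ecomp1e; case: e => h [hb hs hr he].
have og : ordered_edge_set (ecomp (pedge f m) (epath C (pidx f m) (pidx g m))).
  exact: ecomp_order (pedge_order wf m) (epath_order oC fg).
split.
- by move=> a; rewrite -he (ele_refl og).
- by move=> a b; rewrite -!he => /(ele_anti og); apply: bij_inj hb _ _.
- by move=> b a c; rewrite -!he; exact: (ele_trans og).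
- by move=> a b; rewrite -!he (ele_comparable og) !hr.
Qed.

(** Premorphisms with the same indices that are isomorphic level by level are
    equivalent. *)
Lemma premor_equiv_levelwise f
    (G : forall n, edge_set (V B n) (V C (pidx f n))) :
  is_weak_premor f -> is_weak_premor (Premor G) ->
  (forall n, eiso (G n) (pedge f n)) -> premor_equiv (Premor G) f.
Proof.
move=> wf wg e; apply/premor_equivP => //; split=> n; exists n => m nm.
- apply: compat_iso => //=; rewrite epath_diag.
  apply: eiso_trans (eiso_sym (e m)) _; apply/eiso_sym/ecompe1.
  exact: (pedge_order wg m).
- apply: compat_iso => //=; rewrite epath_diag.
  apply: eiso_trans (e m) _; apply/eiso_sym/ecompe1.
  exact: (pedge_order wf m).
Qed.

End Premorphisms.

(** * Bratteli diagrams and premorphisms form categories *)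

Section Categories.

Lemma card1_uniqueP (T : finType) :
  #|T| = 1 <-> exists x : T, forall y, y = x.
Proof.
split=> [/eqP/card1P[x xP]|[x xP]].
  by exists x => y; apply/eqP; have := xP y; rewrite !inE => <-.
by apply/eqP/card1P; exists x => y; rewrite !inE (xP y) eqxx.
Qed.

Lemma premor_id_weak (B : obd_data) : is_obd B -> is_weak_premor (premor_id B).
Proof.
move=> oB; split=> //=.
- by move=> N; exists N.
- have /card1_uniqueP[v v1] := obd_V0 oB; have [p _] := ediag_ex v.
  suff : #|ediag B 0 0| = 1 by [].
  apply/card1_uniqueP; exists p => q; apply: ediag_ext.
  by rewrite (v1 (src p)) (v1 (src q)).
- move=> n; have /card_gt0P[v _] := obd_V oB n.
  by have [p _] := ediag_ex v; apply/card_gt0P; exists p.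
- by move=> n; exact: ediag_order.
- by move=> n w; have [p [_ pw]] := ediag_ex w; exists p.
- move=> n; apply: (@eiso_trans _ _ (E B n)).
    exact: ecompe1 (obd_order oB n).
  apply: eiso_sym; apply: eiso_trans _ (epath1 oB n).
  by apply: ecomp1e; exact: epath_order.
Qed.

Lemma premor_id_src_onto (B : obd_data) : premor_src_onto (premor_id B).
Proof. by move=> n v; have [p [pv _]] := ediag_ex v; exists p. Qed.

Lemma card_ecomp1 (S T U : finType) (F : edge_set S T) (G : edge_set T U) :
  #|F| = 1 -> #|G| = 1 -> rng_onto F -> #|ecomp F G| = 1.
Proof.
move=> /card1_uniqueP[e eP] /card1_uniqueP[g gP] oF.
have [e' e'g] := oF (src g).
apply/card1_uniqueP; exists (epair e'g) => q; apply: ecomp_ext.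
  by rewrite (eP (efst q)) efst_pair (eP e').
by rewrite (gP (esnd q)).
Qed.

Lemma premor_comp_weak (B C D : obd_data) (g : premor C D) (f : premor B C) :
  is_obd B -> is_obd C -> is_obd D ->
  is_weak_premor g -> is_weak_premor f -> is_weak_premor (premor_comp g f).
Proof.
move=> oB oC oD wg wf; split=> //=.
- by rewrite (pidx0 wf) (pidx0 wg).
- by move=> n; apply: pidx_le => //; exact: (pidx_mono wf).
- move=> N; have [m mP] := pidx_unbounded wg N.
  have [n nP] := pidx_unbounded wf m; exists n.
  exact: leq_trans mP (pidx_le wg nP).
- apply: card_ecomp1; first exact: (pedge0 wf).
    have : forall n, n = 0 -> #|pedge g n| = 1 by move=> n ->; exact: (pedge0 wg).
    by apply; exact: (pidx0 wf).
  exact: (pedge_rng wf).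
- move=> n; have /card_gt0P[e _] := pedge_nonempty wg (pidx f n).
  have [e' e'g] := pedge_rng wf (src e).
  by apply/card_gt0P; exists (epair e'g).
- by move=> n; apply: ecomp_order; [exact: (pedge_order wf)|exact: (pedge_order wg)].
- by move=> n; apply: ecomp_rng_onto; [exact: (pedge_rng wf)|exact: (pedge_rng wg)].
- move=> n; have [_ _ e] := compat_self oD wg (pidx_mono wf n).
  apply: eiso_trans (eiso_sym (ecompA _ _ _)) _.
  apply: eiso_trans (ecomp_eiso (pedge_comm wf n) (eiso_refl _)) _.
  apply: eiso_trans (ecompA _ _ _) _.
  apply: eiso_trans (ecomp_eiso (eiso_refl _) e) _.
  exact: eiso_sym (ecompA _ _ _).
Qed.

Lemma premor_comp_src_onto (B C D : obd_data) (g : premor C D) (f : premor B C) :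
  premor_src_onto g -> premor_src_onto f -> premor_src_onto (premor_comp g f).
Proof. by move=> og of_ n; apply: ecomp_src_onto. Qed.

Lemma eventually_compat_comp (B C D : obd_data) (g g' : premor C D)
    (f f' : premor B C) :
  is_obd B -> is_obd C -> is_obd D -> is_weak_premor f' ->
  eventually_compat g g' -> eventually_compat f f' ->
  eventually_compat (premor_comp g f) (premor_comp g' f').
Proof.
move=> oB oC oD wf' gg' ff' n.
have [M MP] := ff' n; have [N NP] := gg' (pidx f n).
have [K KP] := pidx_large N wf'.
exists (maxn M K) => m; rewrite geq_max => /andP[Mm Km].
have [nm fm e1] := MP m Mm; have [_ gm e2] := NP _ (KP m Km).
split=> //=.
apply: eiso_trans (eiso_sym (ecompA _ _ _)) _.
apply: eiso_trans (ecomp_eiso e1 (eiso_refl _)) _.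
apply: eiso_trans (ecompA _ _ _) _.
apply: eiso_trans (ecomp_eiso (eiso_refl _) e2) _.
exact: eiso_sym (ecompA _ _ _).
Qed.

Lemma premor_comp_equiv (B C D : obd_data) (g g' : premor C D)
    (f f' : premor B C) :
  is_obd B -> is_obd C -> is_obd D ->
  is_weak_premor g -> is_weak_premor g' -> is_weak_premor f ->
  is_weak_premor f' -> premor_equiv g g' -> premor_equiv f f' ->
  premor_equiv (premor_comp g f) (premor_comp g' f').
Proof.
move=> oB oC oD wg wg' wf wf' gg' ff'.
have /(premor_equivP oC oD wg wg')[h1 h2] := gg'.
have /(premor_equivP oB oC wf wf')[h3 h4] := ff'.
apply/premor_equivP => //; try exact: premor_comp_weak.
by split; exact: eventually_compat_comp.
Qed.

Lemma OBD_weak_category : category OBD_weak.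
Proof.
split=> /=.
- exact: premor_id_weak.
- exact: premor_comp_weak.
- by move=> B C f oB oC; exact: premor_equiv_refl.
- by move=> B C f g oB oC; exact: premor_equiv_sym.
- by move=> B C f g h oB oC; exact: premor_equiv_trans.
- exact: premor_comp_equiv.
- move=> A B C D h g f oA oB oC oD wh wg wf.
  have w1 := premor_comp_weak oA oB oC wg wf.
  have w2 := premor_comp_weak oB oC oD wh wg.
  apply: (premor_equiv_levelwise oA oD (f := premor_comp (premor_comp h g) f)
    (G := fun n => pedge (premor_comp h (premor_comp g f)) n)).
  + exact: premor_comp_weak.
  + exact: (premor_comp_weak oA oC oD wh w1).
  + by move=> n; exact: ecompA.
- move=> A B f oA oB wf.
  apply: (premor_equiv_levelwise oA oB (f := f)
    (G := fun n => pedge (premor_comp (premor_id B) f) n)) => //.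
  + exact: (premor_comp_weak oA oB oB (premor_id_weak oB) wf).
  + by move=> n; apply: ecompe1; exact: (pedge_order wf).
- move=> A B f oA oB wf.
  apply: (premor_equiv_levelwise oA oB (f := f)
    (G := fun n => pedge (premor_comp f (premor_id A)) n)) => //.
  + exact: (premor_comp_weak oA oA oB wf (premor_id_weak oA)).
  + by move=> n; apply: ecomp1e; exact: (pedge_order wf).
Qed.

Lemma OBD_category : category OBD.
Proof.
have [i c r s t e a l u] := OBD_weak_category.
split=> /=.
- by move=> B oB; split; [exact: premor_id_weak | exact: premor_id_src_onto].
- move=> B C D g f oB oC oD [wg og] [wf of_].
  by split; [exact: premor_comp_weak | exact: premor_comp_src_onto].
- by move=> B C f oB oC [wf _]; exact: r.
- by move=> B C f g oB oC [wf _] [wg _]; exact: s.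
- by move=> B C f g h oB oC [wf _] [wg _] [wh _]; exact: t.
- by move=> B C D g g' f f' oB oC oD [? _] [? _] [? _] [? _]; exact: e.
- by move=> A B C D h g f ? ? ? ? [? _] [? _] [? _]; exact: a.
- by move=> A B f ? ? [? _]; exact: l.
- by move=> A B f ? ? [? _]; exact: u.
Qed.

End Categories.

(** * Tower systems *)

(** [x] lies on floor number [j] of the tower [tw i]. *)
Definition on_floor (X : topologicalType) (I : Type) (tw : I -> tower X)
    (i : I) (j : nat) (x : X) : Prop :=
  j < size (tw i) /\ nth set0 (tw i) j x.

(** An indexed family of towers whose floors partition [X] and are mapped by
    [phi] as in a Kakutani-Rokhlin partition. Floors may be empty and distinct
    indices may have equal towers, so that inverse images of Kakutani-Rokhlin
    partitions under maps that are not onto are included. *)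
Record tower_system (X : topologicalType) (phi : X -> X) (I : Type)
    (tw : I -> tower X) : Prop := TowerSystem {
  ts_pos : forall i, 0 < size (tw i);
  ts_ex : forall x, exists i j, on_floor tw i j x;
  ts_uniq : forall i j i' j' x,
    on_floor tw i j x -> on_floor tw i' j' x -> i = i' /\ j = j';
  ts_next : forall i j x,
    on_floor tw i j x -> j.+1 < size (tw i) -> on_floor tw i j.+1 (phi x);
  ts_last : forall i j x,
    on_floor tw i j x -> j.+1 = size (tw i) -> exists i', on_floor tw i' 0 (phi x) }.

(** [uw] refines [tw] and the top of [uw] is contained in the top of [tw]. *)
Record finer (X : topologicalType) (I J : Type) (tw : I -> tower X)
    (uw : J -> tower X) : Prop := Finer {
  finer_floor : forall t k x y i j,
    on_floor uw t k x -> on_floor uw t k y -> on_floor tw i j x -> on_floor tw i j y;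
  finer_top : forall t k x, on_floor uw t k x -> k.+1 = size (uw t) ->
    exists i j, on_floor tw i j x /\ j.+1 = size (tw i) }.

(** The towers of a family, indexed by the family itself. *)
Definition towers (X : topologicalType) (P : tower_family X) (S : P) : tower X :=
  val S.

(** The inverse image of an indexed family of towers, with the same indices. *)
Definition pulled (X Y : topologicalType) (a : X -> Y) (I : Type)
    (tw : I -> tower Y) (i : I) : tower X := pre_tower a (tw i).

Section Finer.
Variables (X : topologicalType) (phi : X -> X).

Lemma finer_refl (I : Type) (tw : I -> tower X) : tower_system phi tw -> finer tw tw.
Proof.
move=> c; split=> [t k x y i j tx ty ix|t k x tx kt].
  by have [-> ->] := ts_uniq c ix tx.
by exists t, k.
Qed.

Lemma finer_trans (I J K : Type) (tw : I -> tower X) (uw : J -> tower X)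
    (vw : K -> tower X) :
  tower_system phi uw -> finer tw uw -> finer uw vw -> finer tw vw.
Proof.
move=> c tu uv; split=> [t k x y i j tx ty ix|t k x tx kt].
  have [i' [j' ux]] := ts_ex c x.
  exact: (finer_floor tu ux (finer_floor uv tx ty ux) ix).
have [i' [j' [ux uj]]] := finer_top uv tx kt.
exact: (finer_top tu ux uj).
Qed.

(** Since the top of [uw] lies over the top of [tw], the orbit of a point in
    the first floor of [tw i] climbs all of [tw i] before it leaves [uw t]. *)
Lemma occursP (I J : Type) (tw : I -> tower X) (uw : J -> tower X) i t k :
  tower_system phi tw -> tower_system phi uw -> finer tw uw ->
  (forall t k, k < size (uw t) -> nth set0 (uw t) k !=set0) ->
  occurs_at (tw i) (uw t) k <->
  exists y, on_floor uw t k y /\ on_floor tw i 0 y.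
Proof.
move=> ct cu tu ne; split.
  move=> /andP[kt /asboolP sub]; have i0 := ts_pos ct i.
  have kt' : k < size (uw t) by apply: leq_trans kt; rewrite -addn1 leq_add2l.
  have [y ky] := ne _ _ kt'; exists y; split; first by [].
  by split=> //; apply: sub => //; rewrite addn0.
move=> [y [uy ty]].
have climb j : j < size (tw i) ->
    on_floor uw t (k + j) (iter j phi y) /\ on_floor tw i j (iter j phi y).
  elim: j => [_|j IH ji]; first by rewrite addn0.
  have [u1 t1] := IH (ltnW ji); split; last exact: (ts_next ct t1 ji).
  rewrite addnS; apply: (ts_next cu u1).
  rewrite ltn_neqAle (proj1 u1) andbT; apply/eqP => top_u.
  have [i' [j' [t2 j'i']]] := finer_top tu u1 top_u.
  have [ii' jj'] := ts_uniq ct t1 t2; subst i' j'.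
  by rewrite j'i' ltnn in ji.
apply/andP; split.
  have i0 := ts_pos ct i; have := climb (size (tw i)).-1.
  by rewrite prednK// => /(_ (leqnn _)) [[h _] _]; rewrite -(prednK i0) addnS.
apply/asboolP => j ji z tz; have [u1 t1] := climb j ji.
by have [] := finer_floor tu u1 (conj (proj1 u1) tz) t1.
Qed.

End Finer.

Section Pulled.
Variables (X Y : topologicalType) (phi : X -> X) (psi : Y -> Y) (a : X -> Y).

Lemma size_pulled (I : Type) (tw : I -> tower Y) i : size (pulled a tw i) = size (tw i).
Proof. by rewrite size_map. Qed.

Lemma on_floor_pulled (I : Type) (tw : I -> tower Y) i j x :
  on_floor (pulled a tw) i j x <-> on_floor tw i j (a x).
Proof.
rewrite /on_floor size_pulled; split=> -[ji h]; split=> //.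
  by move: h; rewrite (nth_map set0).
by rewrite (nth_map set0).
Qed.

Lemma pulled_finer (I J : Type) (tw : I -> tower Y) (uw : J -> tower Y) :
  finer tw uw -> finer (pulled a tw) (pulled a uw).
Proof.
move=> tu; split=> [t k x y i j|t k x].
  rewrite !on_floor_pulled; exact: (finer_floor tu).
rewrite on_floor_pulled size_pulled => ux kt.
have [i [j [tx ji]]] := finer_top tu ux kt.
by exists i, j; rewrite on_floor_pulled size_pulled.
Qed.

Hypothesis a_equi : forall x, a (phi x) = psi (a x).

Lemma pulled_system (I : Type) (tw : I -> tower Y) :
  tower_system psi tw -> tower_system phi (pulled a tw).
Proof.
move=> c; split=> [i|x|i j i' j' x|i j x|i j x].
- by rewrite size_pulled; exact: (ts_pos c i).
- by have [i [j h]] := ts_ex c (a x); exists i, j; rewrite on_floor_pulled.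
- rewrite !on_floor_pulled; exact: (ts_uniq c).
- rewrite !on_floor_pulled size_pulled a_equi; exact: (ts_next c).
- rewrite !on_floor_pulled size_pulled => h1 h2.
  have [i' h] := ts_last c h1 h2.
  by exists i'; rewrite on_floor_pulled a_equi.
Qed.

End Pulled.

Lemma pulled_id (X : topologicalType) (I : Type) (tw : I -> tower X) :
  pulled idfun tw = tw.
Proof. by apply/funext => i; exact: map_id. Qed.

Lemma pulled_comp (X Y Z : topologicalType) (a : X -> Y) (b : Y -> Z) (I : Type)
    (tw : I -> tower Z) : pulled (b \o a) tw = pulled a (pulled b tw).
Proof. by apply/funext => i; rewrite /pulled /pre_tower -map_comp. Qed.

Section KRPartitions.
Variables (X : topologicalType) (phi : X -> X) (x0 : X).
Implicit Types P : tower_family X.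

Lemma kr_tower_system P : kr_partition phi x0 P -> tower_system phi (@towers X P).
Proof.
move=> kr; split=> [S|x|S j S' j' x [jS Sx] [jS' Sx']|S j x [jS Sx] jS'|
  S j x [jS Sx] jS'].
- exact: kr_tower kr _ (valP S).
- have : [set: X] x by []; rewrite -(kr_cover kr) => -[A [S SP AS] Ax].
  have [j jS Aj] := nthP set0 AS; exists [` SP]%fset, j.
  by split=> //; rewrite /towers /= Aj.
- have [|e ->] := kr_disjoint kr (valP S) (valP S') jS jS'; first by exists x.
  by split=> //; exact: val_inj.
- split=> //; rewrite /towers -(kr_next kr (valP S) jS').
  by exists x.
- have : bottom P (phi x).
    rewrite -(kr_top kr); exists x => //; exists (val S); first exact: valP.
    by move: Sx; rewrite -nth_last /towers -jS'.
  move=> [S' S'P hS']; exists [` S'P]%fset; split; first exact: kr_tower kr _ S'P.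
  by rewrite nth0.
Qed.

Lemma kr_floor_nonempty P : kr_partition phi x0 P ->
  forall (T : P) k, k < size (towers T) -> nth set0 (towers T) k !=set0.
Proof.
move=> kr T k kT; apply: (kr_nonempty kr).
by exists (val T); [exact: valP | exact: mem_nth].
Qed.

Lemma kr_floor_clopen P : kr_partition phi x0 P ->
  forall (T : P) k, clopen (on_floor (@towers X P) T k).
Proof.
move=> kr T k; have [kT|kT] := ltnP k (size (towers T)).
  rewrite (_ : on_floor _ _ _ = nth set0 (towers T) k).
    by apply: (kr_clopen kr); exists (val T); [exact: valP | exact: mem_nth].
  by apply/seteqP; split=> [x []|x].
rewrite (_ : on_floor _ _ _ = set0); first by split; [exact: open0 | exact: closed0].
by apply/seteqP; split=> [x []|x //]; rewrite ltnNge kT.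
Qed.

Lemma topP P x : kr_partition phi x0 P ->
  top P x <-> exists (T : P) k, on_floor (@towers X P) T k x /\ k.+1 = size (towers T).
Proof.
move=> kr; split.
  move=> [S SP Sx]; exists [` SP]%fset, (size S).-1.
  have S0 : 0 < size S by exact: kr_tower kr _ SP.
  rewrite /on_floor /towers /= prednK//; split=> //; split=> //.
  by rewrite nth_last.
move=> [T [k [[kT Tx] k1]]]; exists (val T); first exact: valP.
by rewrite -nth_last -[size (val T)]k1.
Qed.

(** A point of a tower is reached from the top of the partition by going up
    through that tower. *)
Lemma kr_bottom_orbit P (T : P) h x : kr_partition phi x0 P ->
  on_floor (@towers X P) T h x -> exists w, [/\ top P w, x = iter h.+1 phi w &
    forall m, m <= h -> on_floor (@towers X P) T m (iter m.+1 phi w)].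
Proof.
move=> kr; elim: h x => [|h IH] x [hT Tx].
  have : bottom P x by exists (val T); [exact: valP | rewrite -nth0].
  rewrite -(kr_top kr) => -[w tw wx]; exists w; split=> // m.
  by rewrite leqn0 => /eqP ->; split; rewrite //= wx.
have Tx' := Tx; move: Tx'; rewrite /towers -(kr_next kr (valP T) hT) => -[y Ty yx].
have [w [tw yw low]] := IH y (conj (ltnW hT) Ty); exists w; split=> //.
  by rewrite -yx yw.
move=> m; rewrite leq_eqVlt => /predU1P[->|]; last exact: low.
by split=> //; rewrite iterS -yw yx.
Qed.

End KRPartitions.

(** For inverse images of Kakutani-Rokhlin partitions, [finer] is refinement
    together with the inclusion of tops. *)
Lemma finer_krP (X Y : topologicalType) (phi : X -> X) (psi : Y -> Y)
    (x0 : X) (y0 : Y) (a : X -> Y) (Q : tower_family Y) (P : tower_family X) :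
  kr_partition psi y0 Q -> kr_partition phi x0 P ->
  refined_by (pre_family a Q) P /\ top P `<=` top (pre_family a Q) <->
  finer (pulled a (@towers Y Q)) (@towers X P).
Proof.
move=> krQ krP; have cQ := kr_tower_system krQ; have cP := kr_tower_system krP.
have topQ x : top (pre_family a Q) x <-> top Q (a x).
  split=> [[_ /imfsetP[S /= SQ ->]]|[S SQ]].
    by rewrite (last_map (preimage a) S set0) => h; exists S.
  move=> h; exists (pre_tower a S); first by apply/imfsetP; exists S.
  by rewrite (last_map (preimage a) S set0).
split.
  move=> [ref tops]; split=> [T k x y S j Tx Ty|T k x Tx kT].
    rewrite !on_floor_pulled => Sx.
    have [|A [S' /imfsetP[S1 /= S1Q ->]] /mapP[A1 /(nthP set0)[j1 j1S1 <-]] -> sub] :=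
      ref (nth set0 (towers T) k).
      by exists (val T); [exact: valP | exact: mem_nth (proj1 Tx)].
    have S1x : on_floor (@towers Y Q) [` S1Q]%fset j1 (a x).
      by split=> //; apply: sub; exact: (proj2 Tx).
    have [-> ->] := ts_uniq cQ Sx S1x.
    by split=> //; apply: sub; exact: (proj2 Ty).
  have /tops/topQ : top P x by apply/(topP _ krP); exists T, k.
  move=> /(topP _ krQ)[S [j [Sx jS]]]; exists S, j.
  by rewrite on_floor_pulled size_pulled.
move=> f; split.
  move=> B [T TP /(nthP set0)[k kT <-]].
  have [x Tx] : nth set0 T k !=set0 := kr_floor_nonempty krP (T := [` TP]%fset) kT.
  have [S [j Sx]] := ts_ex cQ (a x).
  exists (a @^-1` nth set0 (val S) j).
    exists (pre_tower a (val S)).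
      by apply/imfsetP; exists (val S) => //; exact: valP.
    by apply: map_f; exact: mem_nth (proj1 Sx).
  move=> y Ty; apply: (proj2 (_ : on_floor (@towers Y Q) S j (a y))).
  apply/on_floor_pulled.
  apply: (finer_floor f (t := [` TP]%fset) (k := k) (x := x)) => //.
  by apply/on_floor_pulled.
move=> x /(topP _ krP)[T [k [Tx kT]]].
have [S [j []]] := finer_top f Tx kT; rewrite on_floor_pulled size_pulled => Sx jS.
by apply/topQ/(topP _ krQ); exists S, j.
Qed.

(** * Edge sets between tower systems *)

Section TowerEdges.
Variables (X : topologicalType) (phi : X -> X) (x0 : X).
Variables (I : finType) (tw : I -> tower X) (Q : tower_family X).
Implicit Types e d : tower_edges tw Q.

(** The height in the tower [rng e] at which the tower [src e] starts. *)
Definition epos e : nat :=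
  tagged (val (e : {p : I * {T : Q & 'I_(size (val T)).+1} |
    occurs_at (tw p.1) (val (tag p.2)) (tagged p.2)})).2.

Lemma epos_occurs e : occurs_at (tw (src e)) (towers (rng e)) (epos e).
Proof. exact: (valP (e : {p : I * {T : Q & 'I_(size (val T)).+1} |
    occurs_at (tw p.1) (val (tag p.2)) (tagged p.2)})). Qed.

Lemma ele_tower_edges e d : ele e d = (rng e == rng d) && (epos e <= epos d).
Proof. by []. Qed.

Lemma tower_edge_ext e d :
  src e = src d -> rng e = rng d -> epos e = epos d -> e = d.
Proof.
case: e d => [[i [T k]] h] [[i' [T' k']] h'] /= e1 e2 e3.
rewrite /epos /= in e3; subst; have /= ekk : k = k' by exact: val_inj.
by subst; congr exist; exact: bool_irrelevance.
Qed.

Lemma tower_edge_ex i (T : Q) k : occurs_at (tw i) (towers T) k ->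
  exists e, [/\ src e = i, rng e = T & epos e = k].
Proof.
move=> h; have kT : k < (size (val T)).+1.
  by rewrite ltnS; case/andP: h => h _; apply: leq_trans h; rewrite leq_addr.
by exists (exist (fun p : I * {T : Q & 'I_(size (val T)).+1} =>
    occurs_at (tw p.1) (val (tag p.2)) (tagged p.2))
  (i, Tagged (fun T : Q => 'I_(size (val T)).+1) (Ordinal kT)) h).
Qed.

Lemma edge_end_le e : epos e + size (tw (src e)) <= size (towers (rng e)).
Proof. by case/andP: (epos_occurs e). Qed.

Lemma edge_on_floor e j x : j < size (tw (src e)) ->
  on_floor (@towers X Q) (rng e) (epos e + j) x -> on_floor tw (src e) j x.
Proof.
move=> js [_ h]; split=> //.
by have /andP[_ /asboolP sub] := epos_occurs e; apply: sub.
Qed.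

Hypotheses (ctw : tower_system phi tw) (krQ : kr_partition phi x0 Q).
Let cQ := kr_tower_system krQ.

Lemma epos_lt e : epos e < size (towers (rng e)).
Proof.
apply: leq_trans (edge_end_le e).
by rewrite -[X in X < _]addn0 ltn_add2l; exact: (ts_pos ctw _).
Qed.

(** An orbit that climbs the copy of [src e] inside [rng e]. *)
Lemma edge_point e : exists x, forall j, j < size (tw (src e)) ->
  on_floor (@towers X Q) (rng e) (epos e + j) (iter j phi x) /\
  on_floor tw (src e) j (iter j phi x).
Proof.
have [x ex] := kr_floor_nonempty krQ (epos_lt e); exists x.
have uv j : j < size (tw (src e)) ->
    on_floor (@towers X Q) (rng e) (epos e + j) (iter j phi x).
  elim: j => [|j IH] js; first by rewrite addn0; split=> //; exact: epos_lt.
  rewrite addnS; apply: (ts_next cQ (IH (ltnW js))).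
  by apply: leq_trans (edge_end_le e); rewrite -addnS ltn_add2l.
by move=> j js; split; [exact: uv | apply: edge_on_floor => //; exact: uv].
Qed.

Lemma edge_start e : exists x,
  on_floor (@towers X Q) (rng e) (epos e) x /\ on_floor tw (src e) 0 x.
Proof.
have [x h] := edge_point e; exists x.
by have := h _ (ts_pos ctw _); rewrite addn0.
Qed.

(** Two occurrences in one tower that overlap are equal. *)
Lemma tower_edge_overlap e d i j : rng e = rng d ->
  i < size (tw (src e)) -> j < size (tw (src d)) -> epos e + i = epos d + j ->
  e = d /\ i = j.
Proof.
move=> ed ie jd p.
have [x /(_ _ ie) [u1 t1]] := edge_point e.
have t2 : on_floor tw (src d) j (iter i phi x).
  by apply: edge_on_floor => //; rewrite -ed -p.
have [s ij] := ts_uniq ctw t1 t2.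
split=> //; apply: tower_edge_ext => //.
by move: p; rewrite ij => /addIn.
Qed.

Lemma tower_edge_disjoint e d : rng e = rng d -> e <> d -> epos e <= epos d ->
  epos e + size (tw (src e)) <= epos d.
Proof.
move=> ed ne le; rewrite leqNgt; apply/negP => lt; apply: ne.
have [] // := @tower_edge_overlap e d (epos d - epos e) 0 ed.
- by rewrite ltn_subLR.
- exact: (ts_pos ctw _).
- by rewrite subnKC ?addn0.
Qed.

Lemma epos_inj e d : rng e = rng d -> epos e = epos d -> e = d.
Proof.
move=> ed p; have [] // := @tower_edge_overlap e d 0 0 ed;
  by [exact: (ts_pos ctw _) | rewrite p].
Qed.

Lemma tower_edges_order : ordered_edge_set (tower_edges tw Q).
Proof.
split.
- by move=> e; rewrite ele_tower_edges eqxx leqnn.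
- move=> e d; rewrite !ele_tower_edges => /andP[/andP[/eqP ed h1] /andP[_ h2]].
  by apply: epos_inj => //; apply/eqP; rewrite eqn_leq h1.
- move=> d e f; rewrite !ele_tower_edges.
  by move=> /andP[/eqP-> h1] /andP[/eqP-> h2]; rewrite eqxx (leq_trans h1 h2).
- move=> e d; rewrite !ele_tower_edges [rng d == _]eq_sym.
  by case: eqP => //= _; exact: leq_total.
Qed.

Hypothesis fin : finer tw (@towers X Q).

(** There is an edge from [i] to [T] at height [k] as soon as one point of floor
    [k] of [T] is in the bottom floor of [tw i]. *)
Lemma edge_atP i (T : Q) k :
  (exists e, [/\ src e = i, rng e = T & epos e = k]) <->
  exists x, on_floor (@towers X Q) T k x /\ on_floor tw i 0 x.
Proof.
split=> [[e [<- <- <-]]|h]; first exact: edge_start.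
apply: tower_edge_ex.
exact/(occursP _ _ _ ctw cQ fin (kr_floor_nonempty krQ)).
Qed.

(** The occurrences in a tower of [Q] cover it: the bottom of [Q] lies in the
    bottom of [tw], so that the [tw]-tower met at height [h] starts no lower than
    height 0. *)
Lemma edge_cover (T : Q) h i j x :
  on_floor (@towers X Q) T h x -> on_floor tw i j x ->
  exists e, [/\ src e = i, rng e = T & epos e + j = h].
Proof.
move=> Tx ix; have [w [topw xw low]] := kr_bottom_orbit krQ Tx.
have [T' [k' [T'w k'T]]] : exists (T' : Q) k', on_floor (@towers X Q) T' k' w /\
    k'.+1 = size (towers T') by apply/(topP _ krQ).
have [i0 [j0 [tw0 j0i]]] := finer_top fin T'w k'T.
have start m : exists i j, [/\ j <= m, on_floor tw i j (iter m.+1 phi w) &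
    on_floor tw i 0 (iter (m - j).+1 phi w)].
  elim: m => [|m [i1 [j1 [jm t1 t0]]]].
    by have [i1 t1] := ts_last ctw tw0 j0i; exists i1, 0.
  have [lt|ge] := ltnP j1.+1 (size (tw i1)).
    by exists i1, j1.+1; split=> //; exact: (ts_next ctw t1 lt).
  have e1 : j1.+1 = size (tw i1) by apply/eqP; rewrite eqn_leq ge (proj1 t1).
  by have [i2 t2] := ts_last ctw t1 e1; exists i2, 0; rewrite subn0.
have [i1 [j1 [jh t1 t0]]] := start h.
have [ii jj] : i = i1 /\ j = j1 by apply: (ts_uniq ctw ix); rewrite xw.
subst i1 j1.
have [e [e1 e2 e3]] : exists e, [/\ src e = i, rng e = T & epos e = h - j].
  apply/edge_atP; exists (iter (h - j).+1 phi w); split=> //.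
  by apply: low; exact: leq_subr.
by exists e; split=> //; rewrite e3 subnK.
Qed.

End TowerEdges.

(** Composition of edge sets between tower systems: an occurrence at height [k]
    inside an occurrence at height [l] is an occurrence at height [l + k]. *)
Lemma tower_edges_comp (X Y : topologicalType) (phi : X -> X) (psi : Y -> Y)
    (x0 : X) (y0 : Y) (a : X -> Y) (I : finType) (tw : I -> tower Y)
    (Q : tower_family Y) (P : tower_family X) :
  (forall x, a (phi x) = psi (a x)) -> tower_system psi tw ->
  kr_partition psi y0 Q -> kr_partition phi x0 P ->
  finer tw (@towers Y Q) -> finer (pulled a (@towers Y Q)) (@towers X P) ->
  eiso (ecomp (tower_edges tw Q) (tower_edges (pulled a (@towers Y Q)) P))
       (tower_edges (pulled a tw) P).
Proof.
move=> a_equi ct krQ krP tQ QP.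
have cQ := kr_tower_system krQ; have cP := kr_tower_system krP.
have cta := pulled_system a_equi ct; have cQa := pulled_system a_equi cQ.
have tP : finer (pulled a tw) (@towers X P).
  exact: (finer_trans cQa (pulled_finer a tQ) QP).
have o1 := tower_edges_order ct krQ.
have o2 := tower_edges_order cQa krP.
have o3 := tower_edges_order cta krP.
(* the lower edge starts below the top of the tower that the upper edge places *)
have lt1 (p : ecomp (tower_edges tw Q) (tower_edges (pulled a (@towers Y Q)) P)) :
    epos (efst p) < size (pulled a (@towers Y Q) (src (esnd p))).
  by rewrite size_pulled -ecomp_mid; exact: (epos_lt ct).
apply: (@eiso_rel _ _ _ _ (fun (p : ecomp _ _)
  (e : tower_edges (pulled a tw) P) => [/\ src e = src (efst p),
  rng e = rng (esnd p) & epos e = epos (esnd p) + epos (efst p)])) => //.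
- exact: ecomp_order.
- move=> p; have [x /(_ _ (lt1 p))[u1 u2]] := edge_point cQa krP (esnd p).
  apply/(edge_atP cta krP tP); exists (iter (epos (efst p)) phi x); split=> //.
  move: u2; rewrite -ecomp_mid !on_floor_pulled => u2.
  have [y [v1 v2]] := edge_start ct krQ (efst p).
  exact: (finer_floor tQ v1 u2 v2).
- move=> e; have [x [u1 u2]] := edge_start cta krP e.
  (* [k] is the height of the start of [e] in the [Q]-tower that contains it *)
  have [S [k Sx]] := ts_ex cQ (a x).
  have [d [d1 d2 d3]] : exists d : tower_edges tw Q,
      [/\ src d = src e, rng d = S & epos d = k].
    apply/(edge_atP ct krQ tQ); exists (a x); split=> //.
    exact/(on_floor_pulled a).
  have [g [g1 g2 g3]] : exists g : tower_edges (pulled a (@towers Y Q)) P,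
      [/\ src g = S, rng g = rng e & epos g + k = epos e].
    by apply: (edge_cover cQa krP QP u1); apply/on_floor_pulled.
  have dg : rng d = src g by rewrite d2 g1.
  by exists (epair dg); rewrite efst_pair esnd_pair d1 g2 d3 g3.
- by move=> p e [-> _ _].
- by move=> p e [_ -> _].
- move=> p e p' e' [_ r1 k1] [_ r2 k2].
  rewrite [RHS]ele_tower_edges r1 r2 k1 k2.
  case: (eqVneq (esnd p) (esnd p')) => [e2|/eqP ne].
    by rewrite ele_ecomp_same// ele_tower_edges !ecomp_mid e2 !eqxx leq_add2l.
  rewrite ele_ecomp_diff// ele_tower_edges.
  case: (eqVneq (rng (esnd p)) (rng (esnd p'))) => // rr.
  rewrite !andTb.
  apply/idP/idP => le.
    have dis := tower_edge_disjoint cQa krP rr ne le.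
    apply: leq_trans (leq_addr _ _); apply: leq_trans dis.
    by rewrite leq_add2l ltnW// lt1.
  rewrite leqNgt; apply/negP => lt.
  have dis := tower_edge_disjoint cQa krP (esym rr) (nesym ne) (ltnW lt).
  have := leq_trans dis (leq_trans (leq_addr _ _) le).
  by rewrite leq_add2l leqNgt lt1.
Qed.

(** * Compactness *)

Lemma compact_increasing_cover (X : topologicalType) (G : nat -> set X) :
  compact [set: X] -> (forall n, open (G n)) ->
  (forall m n, m <= n -> G m `<=` G n) -> (forall x, exists n, G n x) ->
  exists N, forall x, G N x.
Proof.
move=> /compact_near_coveringP cX oG mG cG.
have [x _|N _ NP] := cX nat \oo G _.
  have [n nx] := cG x; exists (G n, [set m | n <= m]) => /=.
    by split; [apply: open_nbhs_nbhs; split | exists n].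
  by move=> [y m] /= [Gy nm]; exact: (mG n m nm).
by exists N => x; exact: (NP N (leqnn N)).
Qed.

Lemma compact_nested_nonempty (X : topologicalType) (K : nat -> set X) :
  compact [set: X] -> (forall n, closed (K n)) ->
  (forall m n, m <= n -> K n `<=` K m) -> (forall n, K n !=set0) ->
  exists x, forall n, K n x.
Proof.
move=> cX cK mK neK; apply: contrapT => none.
have [|||N NP] := @compact_increasing_cover X (fun n => ~` K n) cX.
- by move=> n; exact: closed_openC.
- by move=> m n mn; apply: subsetC; exact: mK.
- move=> x; apply: contrapT => h; apply: none; exists x => n.
  by apply: contrapT => nK; apply: h; exists n.
- by have [x Kx] := neK N; exact: NP Kx.
Qed.

(** * The Kakutani-Rokhlin partitions of an object *)

Section Object.
Variables (R : realType) (X : sds R).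

(** The towers of level [n], indexed by the vertices of [P_ob X] at that level. *)
Definition lev (n : nat) : parts X n -> tower X := @towers X (parts X n).

Lemma parts_kr n : kr_partition (@shift R X) (base X) (parts X n).
Proof. exact: krs_partition (sds_kr X) n. Qed.

Lemma lev_system n : tower_system (@shift R X) (@lev n).
Proof. exact: kr_tower_system (parts_kr n). Qed.

Lemma parts0 (T : parts X 0) : towers T = [:: setT].
Proof.
have h (S : tower X) : S \in parts X 0 -> S = [:: setT].
  by rewrite (krs_0 (sds_kr X)) inE => /eqP.
exact/h/valP.
Qed.

Lemma top_parts0 : top (parts X 0) = setT.
Proof.
rewrite (krs_0 (sds_kr X)); apply/seteqP; split=> // x _.
by exists [:: setT] => //; rewrite inE.
Qed.

Lemma pre_family_id (P : tower_family X) : pre_family idfun P = P.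
Proof.
apply/fsetP => S; apply/imfsetP/idP => /= [[S' S'P ->]|SP].
  by rewrite /pre_tower (map_id S').
by exists S => //; rewrite /pre_tower (map_id S).
Qed.

Lemma lev_finer m n : m <= n -> finer (@lev m) (@lev n).
Proof.
elim: n => [|n IH].
  rewrite leqn0 => /eqP ->; exact: finer_refl (lev_system 0).
rewrite leq_eqVlt => /predU1P[->|]; first exact: finer_refl (lev_system n.+1).
rewrite ltnS => /IH h; apply: finer_trans (lev_system n) h _.
rewrite -[@lev n]pulled_id; apply/(finer_krP _ (parts_kr n) (parts_kr n.+1)).
rewrite pre_family_id; split; first exact: krs_refine (sds_kr X) n.
case: (posnP n) => [->|n0]; first by rewrite top_parts0.
exact: (krs_top (sds_kr X) n0).
Qed.

Lemma on_floor_open n (T : parts X n) k : open (on_floor (@lev n) T k).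
Proof. by have [] := kr_floor_clopen (parts_kr n) T k. Qed.

Lemma on_floor_closed n (T : parts X n) k : closed (on_floor (@lev n) T k).
Proof. by have [] := kr_floor_clopen (parts_kr n) T k. Qed.

Lemma top_parts_closed n : closed (top (parts X n)).
Proof.
pose tp (T : parts X n) := on_floor (@lev n) T (size (towers T)).-1.
have e : top (parts X n) = \bigcup_(T in setT) tp T.
  apply/seteqP; split=> x.
    by move=> /(topP _ (parts_kr n))[T [k [Tx kT]]]; exists T => //; rewrite /tp -kT.
  move=> [T _ Tx]; apply/(topP _ (parts_kr n)); exists T, (size (towers T)).-1.
  by split=> //; rewrite prednK//; exact: (ts_pos (lev_system n) T).
rewrite e.
by apply: closed_bigcup => [|T _]; [exact: finite_finset | exact: on_floor_closed].
Qed.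

Lemma sds_hausdorff : hausdorff_space X.
Proof.
have [M [h [ch [g [hK gK cg]]]]] := sds_metrizable X.
have := @metric_hausdorff R M; rewrite !open_hausdorff => hM x y xy.
have hxy : h x != h y by apply: contra_neq xy; exact: (can_inj hK).
have [[A B] /= [xA yB] [oA oB AB]] := hM _ _ hxy.
exists (h @^-1` A, h @^-1` B) => /=; first by rewrite !inE in xA yB *.
split; try by apply: open_comp => // ? _; exact: ch.
by rewrite -preimage_setI (eqP AB) preimage_set0 eqxx.
Qed.

(** The floors separate points. *)
Lemma lev_separated x y :
  (forall n T k, on_floor (@lev n) T k x -> on_floor (@lev n) T k y) -> x = y.
Proof.
move=> same; apply: contrapT => /eqP xy.
have [A [oA xA yA]] := hausdorff_accessible sds_hausdorff xy.
have [_ bX] := krs_basis (sds_kr X).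
have [|B /= [[n _ [S SP BS]] Bx] BA] := bX x A.
  by apply: open_nbhs_nbhs; split=> //; rewrite inE in xA.
have [k kS kB] := nthP set0 BS.
have [] := same n [` SP]%fset k; first by split=> //; rewrite /lev /towers /= kB.
rewrite /lev /towers /= kB => _ /BA yA'.
by move: yA; rewrite inE; apply.
Qed.

Lemma top_base n : exists (T : parts X n) k,
  on_floor (@lev n) T k (base X) /\ k.+1 = size (lev T).
Proof. by apply/(topP _ (parts_kr n)); exact: kr_x0 (parts_kr n). Qed.

Lemma top_parts_base x : (forall n, top (parts X n) x) -> x = base X.
Proof.
by move=> h; have := krs_cap (sds_kr X) => /seteqP[sub _]; apply: sub => n _.
Qed.

Lemma top_parts_le m n : m <= n -> top (parts X n) `<=` top (parts X m).
Proof.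
move=> mn x /(topP _ (parts_kr n))[T [k [Tx kT]]]; apply/(topP _ (parts_kr m)).
exact: (finer_top (lev_finer mn) Tx kT).
Qed.

(** Every tower system with open floors and the base point in its top is refined
    by some partition of the given sequence. *)
Lemma lev_cofinal (I : Type) (tw : I -> tower X) :
  tower_system (@shift R X) tw -> (forall i j, open (on_floor tw i j)) ->
  (exists i j, on_floor tw i j (base X) /\ j.+1 = size (tw i)) ->
  exists N, forall n, N <= n -> finer tw (@lev n).
Proof.
move=> ctw otw btw.
have oX := sds_compact (s := X).
have [||x|N1 N1P] := @compact_increasing_cover X (fun n => [set x | exists T k i j,
    on_floor (@lev n) T k x /\ on_floor (@lev n) T k `<=` on_floor tw i j]) oX.
- move=> n; rewrite openE => x [T [k [i [j [Tx sub]]]]].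
  have := open_nbhs_nbhs (conj (on_floor_open T k) Tx).
  by apply: filterS => y Ty; exists T, k, i, j.
- move=> m n mn x [T [k [i [j [Tx sub]]]]].
  have [T' [k' T'x]] := ts_ex (lev_system n) x; exists T', k', i, j; split=> //.
  by move=> y T'y; apply: sub; exact: (finer_floor (lev_finer mn) T'x T'y Tx).
- have [i [j ijx]] := ts_ex ctw x; have [_ bX] := krs_basis (sds_kr X).
  have [|B /= [[n _ [S SP BS]] Bx] BA] := bX x (on_floor tw i j).
    by apply: open_nbhs_nbhs; split=> //; exact: otw.
  have [k kS kB] := nthP set0 BS.
  exists n, [` SP]%fset, k, i, j; rewrite /on_floor /lev /towers /= kB.
  by split=> // y [_ /BA].
pose tops := [set x | exists i j, on_floor tw i j x /\ j.+1 = size (tw i)].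
have [||x|N2 N2P] :=
  @compact_increasing_cover X (fun n => ~` top (parts X n) `|` tops) oX.
- move=> n; apply: openU; first by apply: closed_openC; exact: top_parts_closed.
  rewrite openE => x [i [j [ijx js]]].
  have := open_nbhs_nbhs (conj (otw i j) ijx).
  by apply: filterS => y ijy; exists i, j.
- by move=> m n mn x [h|h]; [left => /(top_parts_le mn) | right].
- apply: contrapT => h; have xb : x = base X.
    apply: top_parts_base => n; apply: contrapT => nx; apply: h.
    by exists n; left.
  by apply: h; exists 0; right; rewrite xb.
exists (maxn N1 N2) => n; rewrite geq_max => /andP[n1 n2].
split=> [T k x y i j Tx Ty ijx|T k x Tx kT].
  have [T' [k' [i' [j' [T'x sub]]]]] := N1P x.
  have [-> ->] := ts_uniq ctw ijx (sub _ T'x).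
  by apply: sub; exact: (finer_floor (lev_finer n1) Tx Ty T'x).
have [] // := N2P x; case; apply: (top_parts_le n2).
by apply/(topP _ (parts_kr n)); exists T, k.
Qed.

End Object.

(** * The functor on objects *)

Section EdgesOnto.
Variables (X : topologicalType) (phi : X -> X) (x0 : X).
Variables (I : finType) (tw : I -> tower X) (Q : tower_family X).
Hypotheses (ctw : tower_system phi tw) (krQ : kr_partition phi x0 Q).
Hypothesis fin : finer tw (@towers X Q).

Lemma tower_edges_rng_onto : rng_onto (tower_edges tw Q).
Proof.
move=> T; have T0 := ts_pos (kr_tower_system krQ) T.
have [x Tx] := kr_floor_nonempty krQ T0.
have [i [j ix]] := ts_ex ctw x.
by have [e [_ <- _]] := edge_cover ctw krQ fin (conj T0 Tx) ix; exists e.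
Qed.

Lemma tower_edges_src_onto :
  src_onto (tower_edges tw Q) <-> forall i, exists x, on_floor tw i 0 x.
Proof.
split=> [so i|ne i].
  by have [e <-] := so i; have [x [_ h]] := edge_start ctw krQ e; exists x.
have [x ix] := ne i; have [T [k Tx]] := ts_ex (kr_tower_system krQ) x.
by have [e [<- _ _]] := edge_cover ctw krQ fin Tx ix; exists e.
Qed.

Lemma tower_edges_comp_id (P : tower_family X) : kr_partition phi x0 P ->
  finer (@towers X Q) (@towers X P) ->
  eiso (ecomp (tower_edges tw Q) (kr_edges Q P)) (tower_edges tw P).
Proof.
move=> krP QP.
have := @tower_edges_comp X X phi phi x0 x0 idfun I tw Q P (fun=> erefl) ctw krQ krP fin.
by rewrite !pulled_id; apply.
Qed.

End EdgesOnto.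

Section FunctorOb.
Variables (R : realType) (X : sds R).

Lemma P_ob_obd : is_obd (P_ob X).
Proof.
have V1 : #|V (P_ob X) 0| = 1 by rewrite /= -cardfE (krs_0 (sds_kr X)) cardfs1.
have ne n : 0 < #|V (P_ob X) n|.
  have [T _] := top_base X n; by apply/card_gt0P; exists T.
have rn n : rng_onto (E (P_ob X) n).
  exact: (tower_edges_rng_onto (lev_system X n) (parts_kr X n.+1)
    (lev_finer X (leqnSn n))).
split=> // n.
- have /card_gt0P[T _] := ne n.+1.
  by have [e _] := rn n T; apply/card_gt0P; exists e.
- exact: (tower_edges_order (lev_system X n) (parts_kr X n.+1)).
- apply/(tower_edges_src_onto (lev_system X n) (parts_kr X n.+1)
    (lev_finer X (leqnSn n))).
  move=> T; have T0 := ts_pos (lev_system X n) T.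
  by have [x Tx] := kr_floor_nonempty (parts_kr X n) T0; exists x.
Qed.

Lemma ediag_kr n : eiso (ediag (P_ob X) n n) (tower_edges (@lev _ X n) (parts X n)).
Proof.
have cn := lev_system X n; have kn := parts_kr X n.
apply: (@eiso_rel _ _ _ _ (fun (p : ediag (P_ob X) n n)
  (e : tower_edges (@lev _ X n) (parts X n)) =>
  [/\ src p = src e, rng p = rng e & epos e = 0])).
- exact: ediag_order.
- exact: (tower_edges_order cn kn).
- move=> p; have T0 := ts_pos cn (src p).
  have [x Tx] := kr_floor_nonempty kn T0.
  have [|e [e1 e2 e3]] := proj2 (edge_atP cn kn (finer_refl cn) (src p) (src p) 0).
    by exists x.
  by exists e; rewrite -(ediagP p) e1 e2.
- move=> e; have [x [h1 h2]] := edge_start cn kn e.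
  have [e1 e2] := ts_uniq cn h1 h2.
  have [p [p1 p2]] := @ediag_ex (P_ob X) n (src e).
  by exists p; rewrite p1 p2 e1.
- by move=> p e [].
- by move=> p e [].
- move=> p e p' e' [s1 r1 h1] [s2 r2 h2].
  rewrite ele_ediag ele_tower_edges h1 h2 leqnn andbT -r1 -r2.
  by apply/eqP/eqP => [-> //|h]; apply: ediag_ext; rewrite !ediagP.
Qed.

Lemma epath_kr k l : k <= l ->
  eiso (epath (P_ob X) k l) (tower_edges (@lev _ X k) (parts X l)).
Proof.
elim: l => [|l IH].
  by rewrite leqn0 => /eqP ->; rewrite epath_diag; exact: ediag_kr.
rewrite leq_eqVlt => /predU1P[kl|].
  by subst k; rewrite epath_diag; exact: ediag_kr.
rewrite ltnS => kl; rewrite epathS//.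
apply: eiso_trans (ecomp_eiso (IH kl) (eiso_refl _)) _.
exact: (tower_edges_comp_id (lev_system X k) (parts_kr X l) (lev_finer X kl)
  (parts_kr X l.+1) (lev_finer X (leqnSn l))).
Qed.

End FunctorOb.

(** * The functor on morphisms *)

Section FunctorArr.
Variables (R : realType) (X Y : sds R) (a : X -> Y).
Hypothesis ma : is_sds_mor a.

(** The inverse images under [a] of the towers of [Y] of level [n]. *)
Definition plev (n : nat) : parts Y n -> tower X := pulled a (@lev _ Y n).

Lemma plev_system n : tower_system (@shift R X) (@plev n).
Proof. by case: ma => _ h _; exact: (pulled_system h (lev_system Y n)). Qed.

Lemma admissibleP f : admissible a f <->
  [/\ f 0 = 0, forall n, f n <= f n.+1, forall N, exists n, N <= f n &
      forall n, finer (@plev n) (@lev _ X (f n))].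
Proof.
by split=> -[h1 h2 h3 h4]; split=> // n;
  apply/(finer_krP a (parts_kr Y n) (parts_kr X (f n))); exact: h4.
Qed.

Lemma admissible_ex : exists f, admissible a f.
Proof.
have [ca ea ba] := ma.
have N n : exists N, forall m, N <= m -> finer (@plev n) (@lev _ X m).
  apply: lev_cofinal; first exact: plev_system.
    move=> S j; rewrite (_ : on_floor _ _ _ = a @^-1` on_floor (@lev _ Y n) S j).
      by apply: open_comp => [x _|]; [exact: ca | exact: on_floor_open].
    by apply/seteqP; split=> x /on_floor_pulled.
  have [T [k [Tb kT]]] := top_base Y n.
  by exists T, k; rewrite on_floor_pulled ba size_pulled.
have [g gP] := choice N.
pose f := fix f n := if n is n'.+1 then maxn (f n') (maxn n (g n)) else 0.
exists f; apply/admissibleP; split=> // [n|M|n].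
- by rewrite leq_max leqnn.
- by exists M; case: M => [//|M]; rewrite /= !leq_max leqnn orbT.
- case: n => [|n]; last by apply: gP; rewrite /= !leq_max leqnn !orbT.
  have one (S : parts Y 0) j x : on_floor (@plev 0) S j x ->
      j = 0 /\ size (@plev 0 S) = 1.
    rewrite /plev => -[]; rewrite size_pulled /lev parts0 /= ltnS leqn0 => /eqP ->.
    by [].
  have uniq (S S' : parts Y 0) : S = S'.
    by apply: val_inj; rewrite [LHS]parts0 [RHS]parts0.
  split=> [T k x y S j _ _ Sx|T k x _ _].
    have [S' [j' S'y]] := ts_ex (plev_system 0) y.
    have [j0 _] := one _ _ _ Sx; have [j'0 _] := one _ _ _ S'y.
    by subst j j'; rewrite (uniq S S').
  have [S [j Sx]] := ts_ex (plev_system 0) x; exists S, j; split=> //.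
  by have [-> ->] := one _ _ _ Sx.
Qed.

Variable f : nat -> nat.
Hypothesis af : admissible a f.

Lemma admissible_finer n p : f n <= p -> finer (@plev n) (@lev _ X p).
Proof.
case/admissibleP: af => _ _ _ h fp.
exact: (finer_trans (lev_system X (f n)) (h n) (lev_finer X fp)).
Qed.

(** Both composites in the defining squares of [P_premor a f] are edge sets
    between an inverse image and a partition of [X]. *)
Lemma P_premor_lower n m : n <= m ->
  eiso (ecomp (epath (P_ob Y) n m) (pedge (P_premor a f) m))
       (tower_edges (@plev n) (parts X (f m))).
Proof.
move=> nm; have [_ ea _] := ma.
apply: eiso_trans (ecomp_eiso (epath_kr Y nm) (eiso_refl _)) _.
exact: (tower_edges_comp ea (lev_system Y n) (parts_kr Y m) (parts_kr X (f m))
  (lev_finer Y nm) (admissible_finer (leqnn _))).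
Qed.

Lemma P_premor_upper n p : f n <= p ->
  eiso (ecomp (pedge (P_premor a f) n) (epath (P_ob X) (f n) p))
       (tower_edges (@plev n) (parts X p)).
Proof.
move=> np.
apply: eiso_trans (ecomp_eiso (eiso_refl _) (epath_kr X np)) _.
exact: (tower_edges_comp_id (plev_system n) (parts_kr X (f n))
  (admissible_finer (leqnn _)) (parts_kr X p) (lev_finer X np)).
Qed.

Lemma P_premor_weak : is_weak_premor (P_premor a f).
Proof.
have rn n : rng_onto (pedge (P_premor a f) n).
  exact: (tower_edges_rng_onto (plev_system n) (parts_kr X (f n))
    (admissible_finer (leqnn _))).
have oP n : ordered_edge_set (pedge (P_premor a f) n).
  exact: (tower_edges_order (plev_system n) (parts_kr X (f n))).
have [f0 mf uf _] := af.
have V0X n : n = 0 -> forall T : parts X n, towers T = [:: setT].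
  by move=> -> T; exact: parts0.
split=> //.
- have [T _] := top_base X (f 0); have [e _] := rn 0 T.
  apply/card1_uniqueP; exists e => e'; apply: tower_edge_ext.
  + by apply: val_inj; rewrite [LHS]parts0 [RHS]parts0.
  + by apply: val_inj; rewrite [LHS]V0X// [RHS]V0X.
  + have p0 (d : tower_edges (@plev 0) (parts X (f 0))) : epos d = 0.
      have := epos_lt (plev_system 0) d.
      by rewrite (V0X (f 0))//= ltnS leqn0 => /eqP.
    by rewrite !p0.
- move=> n; have [T _] := top_base X (f n); have [e _] := rn n T.
  by apply/card_gt0P; exists e.
- move=> n.
  apply: eiso_trans (ecomp_eiso (eiso_sym (epath1 (P_ob_obd Y) n)) (eiso_refl _)) _.
  apply: eiso_trans (P_premor_lower (leqnSn n)) _.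
  exact: (eiso_sym (P_premor_upper (mf n))).
Qed.

(** The edges of [P_premor a f] see exactly the floors that meet the image of
    [a], and that image is compact. *)
Lemma P_premor_src_onto : premor_src_onto (P_premor a f) <-> onto a.
Proof.
have [ca ea ba] := ma.
have so n := tower_edges_src_onto (plev_system n) (parts_kr X (f n))
  (admissible_finer (leqnn _)).
split=> [h y|oa n].
  pose K n := [set x | exists (S : parts Y n) k,
    on_floor (@lev _ Y n) S k y /\ on_floor (@lev _ Y n) S k (a x)].
  have [|||x Kx] := @compact_nested_nonempty X K (sds_compact (s := X)).
  - move=> n; have [S [k Sy]] := ts_ex (lev_system Y n) y.
    rewrite (_ : K n = a @^-1` on_floor (@lev _ Y n) S k).
      by apply: closed_comp => [x _|]; [exact: ca | exact: on_floor_closed].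
    apply/seteqP; split=> x; last by move=> h1; exists S, k.
    by move=> [S' [k' [S'y S'x]]]; have [-> ->] := ts_uniq (lev_system Y n) Sy S'y.
  - move=> m n mn x [S [k [Sy Sx]]].
    have [S' [k' S'y]] := ts_ex (lev_system Y m) y; exists S', k'; split=> //.
    exact: (finer_floor (lev_finer Y mn) Sy Sx S'y).
  - move=> n; have [S [k Sy]] := ts_ex (lev_system Y n) y.
    have [x Sx] := proj1 (so n) (h n) S.
    have up j : j <= k -> on_floor (@plev n) S j (iter j (@shift R X) x).
      elim: j => [//|j IH jk]; apply: (ts_next (plev_system n) (IH (ltnW jk))).
      by rewrite size_pulled (leq_ltn_trans jk)//; case: Sy.
    exists (iter k (@shift R X) x), S, k; split=> //.
    by have /on_floor_pulled := up k (leqnn k).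
  - exists x; apply: esym; apply: lev_separated => n S k Sy.
    have [S' [k' [S'y S'x]]] := Kx n.
    by have [-> ->] := ts_uniq (lev_system Y n) Sy S'y.
apply/so => S; have S0 := ts_pos (lev_system Y n) S.
have [y Sy] := kr_floor_nonempty (parts_kr Y n) S0; have [x xy] := oa y.
by exists x; apply/on_floor_pulled; rewrite xy.
Qed.

End FunctorArr.

Section Functor.
Variable R : realType.

Lemma P_premor_equiv (X Y : sds R) (a : X -> Y) f f' : is_sds_mor a ->
  admissible a f -> admissible a f' -> premor_equiv (P_premor a f) (P_premor a f').
Proof.
move=> ma af af'.
have wf := P_premor_weak ma af; have wf' := P_premor_weak ma af'.
have ev g g' : admissible a g -> admissible a g' ->
    eventually_compat (P_premor a g) (P_premor a g').
  move=> ag ag' n.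
  have [M MP] := pidx_large (g n) (P_premor_weak ma ag').
  exists (maxn n M) => m; rewrite geq_max => /andP[nm Mm].
  split=> //; first exact: MP.
  apply: eiso_trans (P_premor_lower ma ag' nm) _.
  exact: (eiso_sym (P_premor_upper ma ag (MP m Mm))).
apply/(premor_equivP (P_ob_obd Y) (P_ob_obd X) wf wf').
by split; exact: ev.
Qed.

Lemma P_premor_id (X : sds R) f : admissible (idfun : X -> X) f ->
  premor_equiv (P_premor (idfun : X -> X) f) (premor_id (P_ob X)).
Proof.
move=> af; have mi : is_sds_mor (idfun : X -> X) by split=> // x.
have ai : admissible (idfun : X -> X) id.
  apply/admissibleP; split=> // [N|n]; first by exists N.
  by rewrite /plev pulled_id; exact: (finer_refl (lev_system X n)).
have oX := P_ob_obd X.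
have wf := P_premor_weak mi af; have wi := P_premor_weak mi ai.
have w1 := premor_id_weak oX.
apply: (premor_equiv_trans oX oX wf wi w1); first exact: P_premor_equiv.
apply: (premor_equiv_levelwise oX oX (f := premor_id (P_ob X))
  (G := fun n => pedge (P_premor (idfun : X -> X) id) n)) => // n.
apply: eiso_sym; have := ediag_kr X n.
by rewrite -[@lev _ X n]pulled_id.
Qed.

Lemma sds_mor_comp (X Y Z : sds R) (a : X -> Y) (b : Y -> Z) :
  is_sds_mor b -> is_sds_mor a -> is_sds_mor (b \o a).
Proof.
move=> [cb eb bb] [ca ea ba]; split.
- by move=> x; apply: continuous_comp; [exact: ca | exact: cb].
- by move=> x; rewrite /= ea eb.
- by rewrite /= ba bb.
Qed.

Lemma P_premor_comp (X Y Z : sds R) (a : X -> Y) (b : Y -> Z) fa fb f :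
  is_sds_mor b -> is_sds_mor a -> admissible b fb -> admissible a fa ->
  admissible (b \o a) f ->
  premor_equiv (P_premor (b \o a) f) (premor_comp (P_premor a fa) (P_premor b fb)).
Proof.
move=> mb ma ab aa af; have mba := sds_mor_comp mb ma.
have oX := P_ob_obd X; have oY := P_ob_obd Y; have oZ := P_ob_obd Z.
have wa := P_premor_weak ma aa; have wb := P_premor_weak mb ab.
have wc := premor_comp_weak oZ oY oX wa wb.
have fin n : finer (@plev _ _ _ (b \o a) n) (pulled a (@lev _ Y (fb n))).
  by rewrite /plev pulled_comp; apply: pulled_finer; exact: (admissible_finer ab).
have aba : admissible (b \o a) (fun n => fa (fb n)).
  apply/admissibleP; split.
  - exact: (pidx0 wc).
  - exact: (pidx_mono wc).
  - exact: (pidx_unbounded wc).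
  - move=> n; apply: finer_trans (plev_system ma (fb n)) (fin n) _.
    exact: (admissible_finer aa).
have wba := P_premor_weak mba aba.
apply: (premor_equiv_trans oZ oX (P_premor_weak mba af) wba wc).
  exact: P_premor_equiv.
apply: (premor_equiv_levelwise oZ oX (f := premor_comp (P_premor a fa) (P_premor b fb))
  (G := fun n => pedge (P_premor (b \o a) (fun n => fa (fb n))) n)) => // n.
apply: eiso_sym; have [_ ea _] := ma.
have := tower_edges_comp ea (plev_system mb n) (parts_kr Y (fb n))
  (parts_kr X (fa (fb n)))
  (admissible_finer ab (leqnn _)) (admissible_finer aa (leqnn _)).
by rewrite -pulled_comp.
Qed.

Lemma P_all_functor : contravariant_functor (P_all R).
Proof.
split=> /=.
- by move=> X _; exact: P_ob_obd.
- by move=> X Y a _ _ ma; have [f af] := admissible_ex ma; exists (P_premor a f), f.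
- by move=> X Y a g _ _ ma [f af ->]; exact: P_premor_weak.
- move=> X Y a a' g g' _ _ ma _ /funext aa' [f af ->] [f' af' ->].
  by subst a'; exact: P_premor_equiv.
- by move=> X g _ [f af ->]; exact: P_premor_id.
- move=> X Y Z b a gb ga g _ _ _ mb ma [fb ab ->] [fa aa ->] [f af ->].
  exact: P_premor_comp.
Qed.

Lemma P_onto_functor : contravariant_functor (P_onto R).
Proof.
have [h1 h2 h3 h4 h5 h6] := P_all_functor.
split=> //=.
- by move=> X Y a ? ? [ma _]; exact: h2.
- move=> X Y a g ? ? [ma oa] [f af ->]; split; first exact: P_premor_weak.
  by apply/(P_premor_src_onto ma af).
- by move=> X Y a a' g g' ? ? [ma _] [ma' _]; exact: h4.
- by move=> X Y Z b a gb ga g ? ? ? [mb _] [ma _]; exact: h6.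
Qed.

Lemma SDS_category : category (SDS R).
Proof.
split=> //=.
- by move=> X _; split=> // x.
- by move=> X Y Z b a _ _ _; exact: sds_mor_comp.
- by move=> X Y a b _ _ _ _ h x; rewrite h.
- by move=> X Y a b c _ _ _ _ _ h h' x; rewrite h h'.
- by move=> X Y Z b b' a a' _ _ _ _ _ _ _ h h' x /=; rewrite h h'.
Qed.

Lemma SDS_onto_category : category (SDS_onto R).
Proof.
have [h1 h2 h3 h4 h5 h6 h7 h8 h9] := SDS_category.
split=> //=.
- by move=> X _; split; [exact: h1 | move=> x; exists x].
- move=> X Y Z b a _ _ _ [mb ob] [ma oa]; split; first exact: h2.
  by move=> z; have [y <-] := ob z; have [x <-] := oa y; exists x.
- by move=> X Y a b _ _ _ _ h x; rewrite h.
- by move=> X Y a b c _ _ _ _ _ h h' x; rewrite h h'.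
- by move=> X Y Z b b' a a' _ _ _ _ _ _ _ h h' x /=; rewrite h h'.
Qed.

End Functor.

(** * Offsets in ordered edge sets *)

Section Offset.
Variables (S T : finType) (F : edge_set S T) (w : S -> nat).

(** If each source [v] is given a length [w v], the edges into a vertex [t], laid
    end to end in their order, fill an interval of length [fibre_length t], and the
    edge [e] starts at [offset e]. *)
Definition offset (e : F) : nat := \sum_(d : F | ele d e && (d != e)) w (src d).
Definition fibre_length (t : T) : nat := \sum_(e : F | rng e == t) w (src e).

Hypothesis oF : ordered_edge_set F.
Implicit Types e d : F.

Lemma ele_total e d : rng e = rng d -> ele e d \/ ele d e.
Proof. by move=> h; apply/orP; rewrite (ele_comparable oF) h eqxx. Qed.

Lemma offset_add e : offset e + w (src e) = \sum_(d | ele d e) w (src d).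
Proof.
rewrite (bigD1 e) ?(ele_refl oF)//= addnC; congr addn.
Qed.

Lemma leq_sum_sub (P Q : pred F) : (forall d, P d -> Q d) ->
  \sum_(d | P d) w (src d) <= \sum_(d | Q d) w (src d).
Proof.
move=> PQ; rewrite big_mkcond [X in _ <= X]big_mkcond; apply: leq_sum => d _.
by case: ifP => // /PQ ->.
Qed.

Lemma offset_lt e d : ele e d -> e <> d -> offset e + w (src e) <= offset d.
Proof.
move=> ed ne; rewrite offset_add; apply: leq_sum_sub => c ce.
rewrite (ele_trans oF ce ed) /=; apply/eqP => cd; subst c.
exact: (ne (ele_eq oF ed ce)).
Qed.

Lemma offset_le_length e : offset e + w (src e) <= fibre_length (rng e).
Proof. by rewrite offset_add; apply: leq_sum_sub => c /(ele_rng oF) ->. Qed.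

Lemma offset_min e : (forall d, ele d e -> d = e) -> offset e = 0.
Proof. by move=> h; apply: big_pred0 => d; apply/andP => -[/h -> /eqP]. Qed.

Lemma offset_succ e d : ele d e -> d <> e ->
  (forall c, ele c e -> c <> e -> ele c d) -> offset e = offset d + w (src d).
Proof.
move=> de ne h; apply/eqP; rewrite eqn_leq (offset_lt de ne) andbT offset_add.
by apply: leq_sum_sub => c /andP[ce /eqP cne]; exact: h.
Qed.

Lemma fibre_length_max e : (forall c, rng c = rng e -> ele c e) ->
  fibre_length (rng e) = offset e + w (src e).
Proof.
move=> h; apply/eqP; rewrite eqn_leq offset_le_length andbT offset_add.
by apply: leq_sum_sub => c /eqP /h.
Qed.

(** The intervals of distinct edges into the same vertex are disjoint. *)
Lemma offset_overlap e d i j : rng e = rng d -> i < w (src e) -> j < w (src d) ->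
  offset e + i = offset d + j -> e = d /\ i = j.
Proof.
wlog: e d i j / ele e d => [H ed iw jw p|ed rr iw jw p].
  have [h|h] := ele_total ed; first exact: H.
  by have [-> ->] := H d e j i h (esym ed) jw iw (esym p).
have [ed'|/eqP ne] := eqVneq e d; first by subst d; split=> //; apply: addnI p.
have := offset_lt ed ne; rewrite leqNgt => /negP[].
by apply: (leq_ltn_trans (leq_addr j _)); rewrite -p ltn_add2l.
Qed.

Lemma ele_offset e d : (forall v, 0 < w v) ->
  ele e d = (rng e == rng d) && (offset e <= offset d).
Proof.
move=> w0; case: (eqVneq (rng e) (rng d)) => [ed|/eqP ne] /=; last first.
  by apply/negP => /(ele_rng oF).
have [->|/eqP ne] := eqVneq e d; first by rewrite leqnn (ele_refl oF).
apply/idP/idP => [h|le]; first exact: (leq_trans (leq_addr _ _) (offset_lt h ne)).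
have [//|h] := ele_total ed; have := leq_trans (offset_lt h (nesym ne)) le.
by rewrite -[X in _ <= X]addn0 leq_add2l leqNgt w0.
Qed.

End Offset.

Lemma fibre_max (S T : finType) (F : edge_set S T) (P : pred F) t (d0 : F) :
  ordered_edge_set F -> (forall c, P c -> rng c = t) -> P d0 ->
  exists d, P d /\ forall c, P c -> ele c d.
Proof.
move=> oF Pt P0; pose w (_ : S) := 1.
case: (arg_maxnP (offset w) P0) => d Pd dmax; exists d; split=> // c Pc.
have [//|h] : ele c d \/ ele d c by apply: ele_total => //; rewrite !Pt.
have [->|/eqP ne] := eqVneq c d; first exact: (ele_refl oF d).
have := offset_lt w oF h (nesym ne); rewrite addn1 => lt.
by have := leq_trans lt (dmax c Pc); rewrite ltnn.
Qed.

Section OffsetMore.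
Variables (S T : finType) (F : edge_set S T) (w : S -> nat).
Hypothesis oF : ordered_edge_set F.
Implicit Types e d : F.

(** The intervals of the edges into [t] cover the interval of length [fibre_length t]. *)
Lemma offset_cover t j : (forall v, 0 < w v) -> j < fibre_length F w t ->
  exists e i, [/\ rng e = t, i < w (src e) & offset w e + i = j].
Proof.
move=> w0 jt; have [e0 e0t] : exists e : F, rng e = t.
  apply: contrapT => none; move: jt; rewrite /fibre_length big_pred0// => e.
  by apply/eqP => et; apply: none; exists e.
have [m [/eqP mt mmax]] : exists m : F, rng m == t /\ forall c, rng c == t -> ele c m.
  by apply: (@fibre_max _ _ _ (fun c => rng c == t) t e0) => //;
    [move=> c /eqP | apply/eqP].
pose C e := (rng e == t) && (j < offset w e + w (src e)).
have mP : C m; rewrite /C.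
  rewrite mt eqxx -(fibre_length_max w oF) ?mt// => c cm.
  by apply: mmax; rewrite cm.
case: (arg_minnP (P := C) (offset w) mP) => e /andP[/eqP et je] emin.
suff ej : offset w e <= j.
  by exists e, (j - offset w e); rewrite subnKC//; split=> //; rewrite ltn_subLR.
have [h|/existsNP[d0 /not_implyP[d0e d0ne]]] := pselect (forall d, ele d e -> d = e).
  by rewrite offset_min.
have [d [/andP[de /eqP dne] dmax]] :
    exists d : F, ele d e && (d != e) /\ forall c, ele c e && (c != e) -> ele c d.
  apply: (@fibre_max _ _ _ (fun c => ele c e && (c != e)) (rng e) d0) => //.
    by move=> c /andP[/(ele_rng oF)].
  by rewrite d0e; apply/eqP.
have es : offset w e = offset w d + w (src d).
  apply: offset_succ => // c ce /eqP cne; apply: dmax; exact/andP.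
rewrite es leqNgt; apply/negP => jd.
have := emin d; rewrite /C (ele_rng oF de) et eqxx jd => /(_ isT).
by rewrite es -[X in _ <= X]addn0 leq_add2l leqNgt w0.
Qed.

Lemma offset_eiso (G : edge_set S T) (h : F -> G) :
  bijective h -> (forall e, src (h e) = src e) ->
  (forall e e', ele (h e) (h e') = ele e e') ->
  forall e, offset w (h e) = offset w e.
Proof.
move=> hb hs he e; rewrite /offset (reindex h) /=; last exact: onW_bij.
apply: eq_big => [d|d _]; last by rewrite hs.
by rewrite he (inj_eq (bij_inj hb)).
Qed.

Lemma fibre_length_eiso (G : edge_set S T) t :
  eiso F G -> fibre_length F w t = fibre_length G w t.
Proof.
case=> h [hb hs hr he]; rewrite /fibre_length [RHS](reindex h) /=; last exact: onW_bij.
by apply: eq_big => [d|d _]; rewrite ?hr ?hs.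
Qed.

End OffsetMore.

Section OffsetComp.
Variables (S T U : finType) (F : edge_set S T) (G : edge_set T U) (w : S -> nat).

Lemma sum_ecomp (P : pred (ecomp F G)) (Q : F -> G -> bool) :
  (forall p, P p = Q (efst p) (esnd p)) ->
  \sum_(p | P p) w (src p) =
  \sum_(g : G) \sum_(e : F | (rng e == src g) && Q e g) w (src e).
Proof.
move=> PQ; rewrite pair_big_dep /=.
rewrite [RHS](reindex_omap (fun p : ecomp F G => (esnd p, efst p))
    (fun q : G * F => insub (q.2, q.1) : option (ecomp_edge F G))) /=; last first.
  by move=> [g e] /= /andP[eg _]; rewrite insubT.
apply: eq_bigl => p; rewrite PQ ecomp_mid eqxx /= /efst /esnd.
by rewrite -surjective_pairing valK eqxx andbT.
Qed.

Lemma fibre_length_ecomp u :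
  fibre_length (ecomp F G) w u = fibre_length G (fibre_length F w) u.
Proof.
rewrite /fibre_length (sum_ecomp (Q := fun _ g => rng g == u))//.
rewrite [RHS]big_mkcond; apply: eq_bigr => g _.
case: ifP => gu; first by apply: eq_bigl => e; rewrite andbT.
by rewrite big_pred0// => e; rewrite andbF.
Qed.

(** The paths into [u] before [p] are those through an earlier upper edge, which
    fill the interval before [esnd p], and those through [esnd p] itself. *)
Lemma offset_ecomp (p : ecomp F G) : ordered_edge_set F -> ordered_edge_set G ->
  offset w p = offset (fibre_length F w) (esnd p) + offset w (efst p).
Proof.
move=> oF oG; rewrite /offset (sum_ecomp (Q := fun e g =>
  ((g != esnd p) && ele g (esnd p)) || [&& g == esnd p, ele e (efst p) & e != efst p])).
  rewrite (bigD1 (esnd p))//= addnC; congr addn.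
    rewrite [RHS]big_mkcond [LHS]big_mkcond; apply: eq_bigr => g _.
    case: (eqVneq g (esnd p)) => [->|ne] /=; first by rewrite andbF.
    rewrite andbT; case: ifP => h; first by apply: eq_bigl => e; rewrite orbF andbT.
    by rewrite big_pred0// => e; rewrite andbF.
  apply: eq_bigl => e; rewrite eqxx /=.
  case: (boolP (ele e _)) => [h|]; last by rewrite andbF.
  by rewrite (ele_rng oF h) ecomp_mid eqxx.
move=> q; rewrite ele_ecomp ecomp_eqE.
by case: (eqVneq (esnd q)) => [e|ne] /=; rewrite ?andbT ?orbF ?andbF ?andbT.
Qed.

End OffsetComp.

(** In an edge set between tower systems, with the heights of the towers as
    lengths, the offset of an occurrence is the height at which it starts, and
    the occurrences in a tower fill it. *)
Section TowerOffset.
Variables (X : topologicalType) (phi : X -> X) (x0 : X).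
Variables (I : finType) (tw : I -> tower X) (Q : tower_family X).
Hypotheses (ctw : tower_system phi tw) (krQ : kr_partition phi x0 Q).
Hypothesis fin : finer tw (@towers X Q).
Implicit Types e d : tower_edges tw Q.
Variable height : I -> nat.
Hypothesis heightE : forall i, size (tw i) = height i.
Let oE := tower_edges_order ctw krQ.

(** If an occurrence starts at height [k > 0] of a tower, or if [k] is the height
    of the tower, then the last occurrence starting below [k] ends at [k]. *)
Lemma edge_below (T : Q) k : 0 < k -> k <= size (towers T) ->
  (exists e, rng e = T /\ epos e = k) \/ k = size (towers T) ->
  exists d, [/\ rng d = T, epos d + height (src d) = k &
    forall c, rng c = T -> epos c < k -> ele c d].
Proof.
move=> k0 kT kend; have k1 : k.-1 < size (towers T) by rewrite prednK.
have [x Tx] := kr_floor_nonempty krQ k1.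
have [i [j ix]] := ts_ex ctw x.
have [d [di dT dj]] := edge_cover ctw krQ fin (conj k1 Tx) ix.
have dk : epos d + height (src d) = k.
  have kd : k <= epos d + size (tw (src d)).
    by rewrite -(prednK k0) -dj -addnS leq_add2l di; exact: (proj1 ix).
  apply/eqP; rewrite -heightE eqn_leq kd andbT.
  case: kend => [[e [eT ek]]|->]; last by rewrite -dT; exact: edge_end_le.
  have lt : epos d < epos e by rewrite ek -(prednK k0) -dj ltnS leq_addr.
  rewrite -ek; apply: (tower_edge_disjoint ctw krQ); rewrite ?dT ?eT//.
    by move=> de; rewrite de ltnn in lt.
  exact: ltnW.
exists d; split=> // c cT ck; rewrite ele_tower_edges cT dT eqxx /=.
rewrite leqNgt; apply/negP => lt.
have dc : d <> c by move=> dc; rewrite dc ltnn in lt.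
have := tower_edge_disjoint ctw krQ (etrans dT (esym cT)) dc (ltnW lt).
by rewrite heightE dk leqNgt ck.
Qed.

Lemma offset_tower_edges e : offset height e = epos e.
Proof.
have [n] := ubnP (epos e); elim: n e => [//|n IH] e; rewrite ltnS => en.
case: (posnP (epos e)) => [e0|e0].
  rewrite e0; apply: (offset_min height) => d.
  rewrite ele_tower_edges e0 leqn0 => /andP[/eqP de /eqP d0].
  by apply: (epos_inj ctw krQ de); rewrite d0 e0.
have [||d [dT dk dmax]] := @edge_below (rng e) (epos e) e0.
- exact: (ltnW (epos_lt ctw e)).
- by left; exists e.
have de : epos d < epos e.
  by rewrite -dk -[X in X < _]addn0 ltn_add2l -heightE; exact: (ts_pos ctw _).
have ne : d <> e by move=> h; rewrite h ltnn in de.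
rewrite (offset_succ height oE (d := d)) ?IH//.
- exact: (leq_trans de en).
- by rewrite ele_tower_edges dT eqxx ltnW.
- move=> c; rewrite ele_tower_edges => /andP[/eqP ce le] cne; apply: dmax => //.
  rewrite ltn_neqAle le andbT; apply/eqP => p; apply: cne.
  exact: (epos_inj ctw krQ ce).
Qed.

Lemma fibre_length_tower_edges (T : Q) :
  fibre_length (tower_edges tw Q) height T = size (towers T).
Proof.
have T0 := ts_pos (kr_tower_system krQ) T.
have [||d [dT dk dmax]] := @edge_below T _ T0; first exact: leqnn.
  by right.
rewrite -dk -(offset_tower_edges d) -{1}dT; apply: fibre_length_max => // c cd.
by apply: dmax; rewrite ?cd ?dT//; rewrite -dT -cd; exact: (epos_lt ctw c).
Qed.

End TowerOffset.

(** * Faithfulness *)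

Lemma P_premor_equiv_eq (R : realType) (X Y : sds R) (a a' : X -> Y) f f' :
  is_sds_mor a -> is_sds_mor a' -> admissible a f -> admissible a' f' ->
  premor_equiv (P_premor a f) (P_premor a' f') -> a =1 a'.
Proof.
move=> ma ma' af af'.
have wf := P_premor_weak ma af; have wf' := P_premor_weak ma' af'.
move=> /(premor_equivP (P_ob_obd Y) (P_ob_obd X) wf wf')[ev _] x.
apply: lev_separated => n S j Sax.
have [m mP] := ev n; have [nm fm e] := mP m (leqnn m).
have := eiso_trans (eiso_sym (P_premor_lower ma' af' nm))
  (eiso_trans e (P_premor_upper ma af fm)).
case=> [h [hb hs hr he]].
have [T [k Tx]] := ts_ex (lev_system X (f' m)) x.
have Sx : on_floor (@plev _ X Y a n) S j x by apply/on_floor_pulled.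
have kX := parts_kr X (f' m).
have [d [d1 d2 d3]] := edge_cover (plev_system ma n) kX (admissible_finer af fm) Tx Sx.
have [g gK hK] := hb; pose e' := g d.
have r' : rng e' = T by rewrite -hr hK.
have s' : src e' = S by rewrite -hs hK.
have p' : epos e' = epos d.
  have size_plev (b : X -> Y) i : size (@plev _ X Y b n i) = size (@lev _ Y n i).
    exact: size_pulled.
  rewrite -(offset_tower_edges (plev_system ma' n) kX
    (admissible_finer af' (pidx_le wf' nm)) (size_plev a')).
  rewrite -(offset_tower_edges (plev_system ma n) kX
    (admissible_finer af fm) (size_plev a)).
  by rewrite -(offset_eiso _ hb hs he) hK.
apply/(on_floor_pulled a'); rewrite -s'; apply: edge_on_floor.
  by rewrite s' size_pulled; case/on_floor_pulled: Sx.
by rewrite r' p' d3.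
Qed.

Lemma P_all_faithful (R : realType) : faithful (P_all R).
Proof.
move=> X Y a a' g g' _ _ /= ma ma' [f af ->] [f' af' ->].
exact: P_premor_equiv_eq.
Qed.

Lemma P_onto_faithful (R : realType) : faithful (P_onto R).
Proof.
move=> X Y a a' g g' _ _ /= [ma _] [ma' _] [f af ->] [f' af' ->].
exact: P_premor_equiv_eq.
Qed.

(** * Fullness *)

Section Fullness.
Variables (R : realType) (X Y : sds R) (g : premor (P_ob Y) (P_ob X)).
Hypothesis wg : is_weak_premor g.
Let f := pidx g.

(** The height of a tower of level [n]. *)
Definition height (Z : sds R) (n : nat) (S : parts Z n) : nat := size (@lev _ Z n S).

Lemma height_gt0 (Z : sds R) n (S : parts Z n) : 0 < height S.
Proof. exact: (ts_pos (lev_system Z n) S). Qed.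

Lemma fibre_length_E (Z : sds R) n (T : parts Z n.+1) :
  fibre_length (E (P_ob Z) n) (@height Z n) T = height T.
Proof.
exact: (fibre_length_tower_edges (lev_system Z n) (parts_kr Z n.+1)
  (lev_finer Z (leqnSn n))).
Qed.

Lemma fibre_length_epath (Z : sds R) m n (T : parts Z n) : m <= n ->
  fibre_length (epath (P_ob Z) m n) (@height Z m) T = height T.
Proof.
move=> mn; rewrite (fibre_length_eiso _ _ (epath_kr Z mn)).
exact: (fibre_length_tower_edges (lev_system Z m) (parts_kr Z n) (lev_finer Z mn)).
Qed.

(** The edges of [pedge g n] cut each tower of [X] into towers of [Y]: by the
    commuting squares this passes from one level to the next, and at level 0 a
    single edge stands for a single floor. *)
Lemma fibre_length_pedge n : fibre_length (pedge g n) (@height Y n) = @height X (f n).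
Proof.
apply/funext; elim: n => [|n IH] T.
  have V0X m : m = 0 -> forall T : parts X m, height T = 1.
    by move=> -> T'; rewrite /height /lev parts0.
  rewrite (V0X (f 0) (pidx0 wg)).
  have /card1_uniqueP[e eP] := pedge0 wg.
  have eT : rng e = T by have [e' <-] := pedge_rng wg T; rewrite (eP e').
  rewrite /fibre_length (big_pred1 e) ?/height ?/lev ?parts0// => e'.
  by rewrite /= (eP e') eT !eqxx.
rewrite -(funext (@fibre_length_E Y n)) -fibre_length_ecomp.
rewrite (fibre_length_eiso _ _ (pedge_comm wg n)).
rewrite fibre_length_ecomp (funext IH); exact: (fibre_length_epath _ (pidx_mono wg n)).
Qed.

(** [code n S i x]: laying the towers of level [n] of [Y] end to end along the
    edges of [pedge g n] into the tower of [X] that contains [x], the point [x]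
    lies at height [i] of a copy of [S]. *)
Definition code (n : nat) (S : parts Y n) (i : nat) (x : X) : Prop :=
  exists e : pedge g n, [/\ src e = S, i < height S &
    on_floor (@lev _ X (f n)) (rng e) (offset (@height Y n) e + i) x].

Lemma code_ex n x : exists S i, @code n S i x.
Proof.
have [T [k Tx]] := ts_ex (lev_system X (f n)) x.
have kT : k < fibre_length (pedge g n) (@height Y n) T.
  by rewrite fibre_length_pedge; case: Tx.
have [e [i [eT ie ik]]] := offset_cover (pedge_order wg n) (@height_gt0 Y n) kT.
by exists (src e), i, e; split=> //; rewrite eT ik.
Qed.

Lemma code_uniq n S i S' i' x : @code n S i x -> @code n S' i' x -> S = S' /\ i = i'.
Proof.
move=> [e [<- ie ex]] [e' [<- ie' ex']].
have [rr ko] := ts_uniq (lev_system X (f n)) ex ex'.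
by have [-> ->] := offset_overlap (pedge_order wg n) rr ie ie' ko.
Qed.

Lemma offset_le_height n (e : pedge g n) :
  offset (@height Y n) e + height (src e) <= height (rng e).
Proof.
by rewrite -fibre_length_pedge; exact: (offset_le_length _ (pedge_order wg n) e).
Qed.

Lemma code_next n S i x : @code n S i x -> i.+1 < height S -> @code n S i.+1 (shift x).
Proof.
move=> [e [eS ie ex]] iS; exists e; split=> //; rewrite addnS.
apply: (ts_next (lev_system X (f n)) ex).
by apply: leq_trans (offset_le_height e); rewrite -addnS ltn_add2l eS.
Qed.

Lemma code_last n S i x : @code n S i x -> i.+1 = height S ->
  exists S', @code n S' 0 (shift x).
Proof.
move=> [e [eS ie ex]] iS; have [S' [i' c']] := code_ex n (shift x); exists S'.
suff i0 : i' = 0 by rewrite -i0.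
have [e' [eS' ie' ex']] := c'.
have [lt|ge] := ltnP (offset (@height Y n) e + i).+1 (size (lev (rng e))).
  have [rr ko] := ts_uniq (lev_system X (f n)) ex' (ts_next (lev_system X (f n)) ex lt).
  case: i' {c'} => [//|i'] in ie' ex' ko *.
  have [|||ee ii] := offset_overlap (pedge_order wg n) (w := @height Y n)
    (i := i') (j := i) rr.
  - by rewrite eS' ltnW.
  - by rewrite eS.
  - by apply: succn_inj; rewrite -addnS.
  by move: ie'; rewrite -eS' ee eS ii iS ltnn.
have top_e : (offset (@height Y n) e + i).+1 = size (lev (rng e)).
  by apply/eqP; rewrite eqn_leq ge; case: ex => ->.
have [T' T'x] := ts_last (lev_system X (f n)) ex top_e.
have [_ /eqP] := ts_uniq (lev_system X (f n)) ex' T'x.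
by rewrite addn_eq0 => /andP[_ /eqP].
Qed.

(** The commuting square at level [n] makes the codes at levels [n] and [n.+1]
    coherent: both sides compute the same offsets. *)
Lemma code_down n S' i' x y : @code n.+1 S' i' x ->
  on_floor (@lev _ Y n.+1) S' i' y ->
  exists S i, @code n S i x /\ on_floor (@lev _ Y n) S i y.
Proof.
move=> [e' [eS' ie' ex']] S'y.
have [S [i Sy]] := ts_ex (lev_system Y n) y; exists S, i; split=> //.
have fY := lev_finer Y (leqnSn n).
have [d [dS dS' di]] := edge_cover (lev_system Y n) (parts_kr Y n.+1) fY S'y Sy.
have mid : rng (d : E (P_ob Y) n) = src e' by rewrite eS' dS'.
have [h [hb hs hr he]] := pedge_comm wg n.
have oE := obd_order (P_ob_obd Y) n.
have oF := pedge_order wg n.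
have oS := epath_order (P_ob_obd X) (pidx_mono wg n).
have off1 := offset_ecomp (@height Y n) (epair mid) oE (pedge_order wg n.+1).
set q := h (epair mid) in hb hs hr he.
have off2 := offset_ecomp (@height Y n) (h (epair mid)) oF oS.
rewrite (offset_eiso _ hb hs he) off1 efst_pair esnd_pair in off2.
rewrite (funext (@fibre_length_E Y n)) fibre_length_pedge in off2.
have := epath_kr X (pidx_mono wg n) => -[k [kb ks kr ke]].
have fX := lev_finer X (pidx_mono wg n).
have pk (s : epath (P_ob X) (f n) (f n.+1)) : epos (k s) = offset (@height X (f n)) s.
  rewrite -(offset_eiso _ kb ks ke); symmetry.
  exact: (offset_tower_edges (lev_system X (f n)) (parts_kr X (f n.+1)) fX).
rewrite -pk in off2.
have pd : offset (@height Y n) (d : E (P_ob Y) n) = epos d.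
  exact: (offset_tower_edges (lev_system Y n) (parts_kr Y n.+1) fY).
rewrite pd in off2.
have eS : src (efst (h (epair mid))) = S by rewrite -src_ecomp hs src_ecomp efst_pair dS.
have iS : i < height S by case: Sy.
exists (efst (h (epair mid))); split=> //.
have mid2 : rng (efst (h (epair mid))) = src (k (esnd (h (epair mid)))).
  by rewrite ecomp_mid ks.
rewrite mid2; apply: edge_on_floor.
  rewrite -mid2; apply: leq_trans (offset_le_height _).
  by rewrite ltn_add2l eS.
have rT : rng (k (esnd (h (epair mid)))) = rng e'.
  by rewrite kr -rng_ecomp hr rng_ecomp esnd_pair.
by rewrite rT addnA -off2 -addnA di.
Qed.

(** The floors named by the codes of [x] form a decreasing sequence of nonempty
    closed sets. *)
Lemma code_limit x : exists y, forall n, exists S i,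
  @code n S i x /\ on_floor (@lev _ Y n) S i y.
Proof.
apply: (@compact_nested_nonempty Y (fun n => [set y | exists S i,
  @code n S i x /\ on_floor (@lev _ Y n) S i y]) (sds_compact (s := Y))).
- move=> n; have [S [i c]] := code_ex n x.
  rewrite (_ : mkset _ = on_floor (@lev _ Y n) S i); first exact: on_floor_closed.
  apply/seteqP; split=> y; last by move=> h; exists S, i.
  by move=> [S' [i' [c' h]]]; have [-> ->] := code_uniq c c'.
- move=> m; elim=> [|n IH]; first by rewrite leqn0 => /eqP ->.
  rewrite leq_eqVlt => /predU1P[-> //|]; rewrite ltnS => mn y [S [i [c h]]].
  by apply: IH => //; exact: (code_down c h).
- move=> n; have [S [i c]] := code_ex n x.
  have iS : i < size (@towers Y (parts Y n) S) by case: c => e [].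
  by have [y Sy] := kr_floor_nonempty (parts_kr Y n) iS; exists y, S, i.
Qed.

(* [a x] is a point of all the floors named by the codes of [x] *)
Variable a : X -> Y.
Hypothesis aP : forall x n, exists S i, @code n S i x /\ on_floor (@lev _ Y n) S i (a x).

Lemma code_on_floor n S i x : @code n S i x -> on_floor (@lev _ Y n) S i (a x).
Proof.
move=> c; have [S' [i' [c' h]]] := aP x n.
by have [-> ->] := code_uniq c c'.
Qed.

Lemma on_floor_code n S i x : on_floor (@lev _ Y n) S i (a x) -> @code n S i x.
Proof.
move=> h; have [S' [i' [c' h']]] := aP x n.
by have [-> ->] := ts_uniq (lev_system Y n) h h'.
Qed.

Lemma limit_finer n : finer (@plev _ _ _ a n) (@lev _ X (f n)).
Proof.
split=> [T k x y S i Tx Ty /on_floor_pulled /on_floor_code[e [eS iS ex]]|T k x Tx kT].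
  apply/on_floor_pulled/code_on_floor; exists e; split=> //.
  by have [-> ->] := ts_uniq (lev_system X (f n)) ex Tx.
have [S [i c]] := code_ex n x; exists S, i.
split; first exact/on_floor_pulled/code_on_floor.
have [e [eS iS ex]] := c; rewrite size_pulled; apply/eqP; rewrite eqn_leq iS /=.
have [rr ko] := ts_uniq (lev_system X (f n)) ex Tx.
have := offset_le_height e; rewrite rr /height -kT -ko -addnS leq_add2l eS.
by [].
Qed.

Lemma limit_continuous : continuous a.
Proof.
move=> x U nU; have [_ bY] := krs_basis (sds_kr Y).
have [B /= [[n _ [S SP BS]] Bx] BU] := bY (a x) U nU.
have [i iS iB] := nthP set0 BS.
have Sx : on_floor (@plev _ _ _ a n) [` SP]%fset i x.
  by apply/on_floor_pulled; rewrite /on_floor /lev /towers /= iB.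
have [T [k Tx]] := ts_ex (lev_system X (f n)) x.
have := open_nbhs_nbhs (conj (on_floor_open T k) Tx).
apply: filterS => y Ty; apply: BU.
have /on_floor_pulled := finer_floor (limit_finer n) Tx Ty Sx.
by rewrite /on_floor /lev /towers /= iB => -[].
Qed.

Lemma limit_base : a (base X) = base Y.
Proof.
apply: top_parts_base => n; have [T [k [Tb kT]]] := top_base X (f n).
have [S [i [/on_floor_pulled Sb iS]]] := finer_top (limit_finer n) Tb kT.
by apply/(topP _ (parts_kr Y n)); exists S, i; rewrite iS size_pulled.
Qed.

(** If [a x] leaves the tops at some level, both sides lie one floor above
    [a x] from that level on; otherwise [a x] is the base point, and both sides
    lie in every bottom. *)
Lemma limit_shift x : a (shift x) = shift (a x).
Proof.
have [atop|/existsNP[n0 ntop]] := pselect (forall n, top (parts Y n) (a x)).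
  have [_ [s [sK Ks _]]] := sds_homeo Y.
  rewrite (top_parts_base atop) -[LHS]Ks; congr shift.
  apply: top_parts_base => n.
  have [S [i [c h]]] := aP x n.
  have /(topP _ (parts_kr Y n))[S1 [i1 [h1 iS1]]] := atop n.
  have [e1 e2] := ts_uniq (lev_system Y n) h h1; subst S1 i1.
  have [S' c'] := code_last c iS1.
  have : bottom (parts Y n) (a (shift x)).
    exists (val S'); first exact: valP.
    by rewrite -nth0; have [] := code_on_floor c'.
  by rewrite -(kr_top (parts_kr Y n)) => -[z zt <-]; rewrite sK.
have same n : n0 <= n -> exists S i, on_floor (@lev _ Y n) S i (a (shift x)) /\
    on_floor (@lev _ Y n) S i (shift (a x)).
  move=> nn; have [S [i [c h]]] := aP x n; exists S, i.+1.
  have lt : i.+1 < height S.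
    rewrite ltn_neqAle (proj1 h) andbT; apply/eqP => iS; apply: ntop.
    by apply: (top_parts_le nn); apply/(topP _ (parts_kr Y n)); exists S, i.
  split; first exact: (code_on_floor (code_next c lt)).
  exact: (ts_next (lev_system Y n) h lt).
apply: lev_separated => n S k Sx.
have [S' [i [h1 h2]]] := same (maxn n0 n) (leq_maxl _ _).
exact: (finer_floor (lev_finer Y (leq_maxr n0 n)) h1 h2 Sx).
Qed.

Lemma limit_mor : is_sds_mor a.
Proof.
by split; [exact: limit_continuous | exact: limit_shift | exact: limit_base].
Qed.

Lemma limit_admissible : admissible a f.
Proof.
apply/admissibleP; split; last exact: limit_finer.
- exact: (pidx0 wg).
- exact: (pidx_mono wg).
- exact: (pidx_unbounded wg).
Qed.

(** The edges of [P_premor a f] into a tower are the blocks into which [pedge g n]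
    cuts it. *)
Lemma limit_edges n : eiso (pedge (P_premor a f) n) (pedge g n).
Proof.
have ca := plev_system limit_mor n; have kX := parts_kr X (f n).
apply: (@eiso_rel _ _ _ _ (fun (d : tower_edges (@plev _ _ _ a n) (parts X (f n)))
  (e : pedge g n) => [/\ src d = src e, rng d = rng e &
    epos d = offset (@height Y n) e])).
- exact: (tower_edges_order ca kX).
- exact: (pedge_order wg n).
- move=> d.
  have [x [dx /on_floor_pulled/on_floor_code[e [eS _ ex]]]] := edge_start ca kX d.
  exists e; have [rr ko] := ts_uniq (lev_system X (f n)) ex dx.
  by rewrite eS rr -ko addn0.
- move=> e; have lt : offset (@height Y n) e < height (rng e).
    apply: leq_trans (offset_le_height e).
    by rewrite -[X in X < _]addn0 ltn_add2l height_gt0.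
  have [x ex] := kr_floor_nonempty kX lt.
  apply/(edge_atP ca kX (limit_finer n)); exists x; split=> //.
  apply/on_floor_pulled/code_on_floor; exists e; rewrite addn0.
  by split=> //; exact: height_gt0.
- by move=> d e [].
- by move=> d e [].
- move=> d e d' e' [_ r1 p1] [_ r2 p2].
  rewrite ele_tower_edges r1 r2 p1 p2; symmetry.
  exact: (ele_offset (pedge_order wg n) _ _ (@height_gt0 Y n)).
Qed.

Lemma limit_equiv : premor_equiv (P_premor a f) g.
Proof.
apply: (premor_equiv_levelwise (P_ob_obd Y) (P_ob_obd X) (f := g)
  (G := fun n => pedge (P_premor a f) n)) => //; last exact: limit_edges.
exact: (P_premor_weak limit_mor limit_admissible).
Qed.

End Fullness.

Lemma premor_realized (R : realType) (X Y : sds R) (g : premor (P_ob Y) (P_ob X)) :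
  is_weak_premor g -> exists a : X -> Y, [/\ is_sds_mor a, admissible a (pidx g),
    premor_equiv (P_premor a (pidx g)) g &
    forall n, eiso (pedge (P_premor a (pidx g)) n) (pedge g n)].
Proof.
move=> wg; have [a aP] := choice (code_limit wg); exists a; split.
- exact: (limit_mor wg aP).
- exact: (limit_admissible wg aP).
- exact: (limit_equiv wg aP).
- exact: (limit_edges wg aP).
Qed.

Lemma P_all_full (R : realType) : full (P_all R).
Proof.
move=> X Y g _ _ wg; have [a [ma aa e _]] := premor_realized wg.
exists a; split=> //; exists (P_premor a (pidx g)) => //.
by exists (pidx g).
Qed.

Lemma P_onto_full (R : realType) : full (P_onto R).
Proof.
move=> X Y g _ _ [wg og]; have [a [ma aa e ei]] := premor_realized wg.
exists a; split.
  split=> //; apply/(P_premor_src_onto ma aa) => n.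
  exact: (eiso_src_onto (eiso_sym (ei n)) (og n)).
exists (P_premor a (pidx g)) => //.
by exists (pidx g).
Qed.

Theorem theorem3p8 (R : realType) :
  [/\ category (SDS_onto R), category OBD,
      contravariant_functor (P_onto R), full (P_onto R) & faithful (P_onto R)]
  /\
  [/\ category (SDS R), category OBD_weak,
      contravariant_functor (P_all R), full (P_all R) & faithful (P_all R)]
  /\
  (forall (X Y : sds R) (a : X -> Y) (g : premor (P_ob Y) (P_ob X)),
     is_sds_mor a -> P_arr a g -> (premor_src_onto g <-> onto a)).
Proof.
split; last split.
- split; [exact: SDS_onto_category | exact: OBD_category | exact: P_onto_functor
         | exact: P_onto_full | exact: P_onto_faithful].
- split; [exact: SDS_category | exact: OBD_weak_category | exact: P_all_functor
         | exact: P_all_full | exact: P_all_faithful].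
- by move=> X Y a g ma [f af ->]; exact: P_premor_src_onto.
Qed.
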